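(* Let $T$ be a complete first-order theory with monster model $\mathfrak{C}$, and assume that $T$ is simple. Then forking (in $T$) has dual finite character.
   Context: Setting: $T$ is a complete first-order theory in a language $L(T)$, and $\mathfrak{C}$ is its monster model, i.e. a $\kappa$-saturated, strongly $\kappa$-homogeneous model of $T$ for a suitably large cardinal $\kappa > |L(T)|+\aleph_0$. As usual, all sets of parameters are small (of cardinality less than $\kappa$), and all tuples and parameters are from $\mathfrak{C}$. A formula is over $A$ if it has parameters from $A$; $\models\phi[\bar{a}]$ means $\mathfrak{C}\models\phi[\bar{a}]$. Forking: A formula $\phi(\bar{x},\bar{a})$ with parameters $\bar{a}$ divides over a set $A$ if there are $k<\omega$ and a sequence $\langle \bar{a}_i \mid i<\omega\rangle$ such that $\mathrm{tp}(\bar{a}_i/A)=\mathrm{tp}(\bar{a}/A)$ for all $i<\omega$ and $\{\phi(\bar{x},\bar{a}_i) \mid i<\omega\}$ is $k$-inconsistent (for any $i_1<\dots<i_k<\omega$, the formula $\bigwedge_{l=1}^{k}\phi(\bar{x},\bar{a}_{i_l})$ is not satisfiable in $\mathfrak{C}$). A type $p(\bar{x})$ forks over $A$ if there are finitely many formulas $\phi_0(\bar{x},\bar{a}_0),\dots,\phi_{n-1}(\bar{x},\bar{a}_{n-1})$ (with parameters anywhere in $\mathfrak{C}$), each dividing over $A$, such that $p(\bar{x}) \vdash \bigvee_{l<n}\phi_l(\bar{x},\bar{a}_l)$. Simplicity: $T$ is simple if no formula has the tree property. A formula $\phi(\bar{x},\bar{y})$ has the tree property if there are $2 \le k<\omega$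 and tuples $(\bar{a}_s)_{s\in \omega^{<\omega}}$ in $\mathfrak{C}$ such that for every $s\in\omega^{<\omega}$ the set $\{\phi(\bar{x},\bar{a}_{s^\frown \langle i\rangle}) \mid i<\omega\}$ is $k$-inconsistent, and for every $\eta\in\omega^\omega$ the set $\{\phi(\bar{x},\bar{a}_{\eta\upharpoonright n}) \mid 1\le n<\omega\}$ is consistent. Dual finite character (DFC): forking has DFC if for every set $A$ and all finite tuples $\bar{b},\bar{c}$ such that $\mathrm{tp}(\bar{c}/A\bar{b})$ forks over $A$, there is a formula $\phi(\bar{x},\bar{y})$ over $A$ such that $\models\phi[\bar{c},\bar{b}]$, and for every tuple $\bar{b}'$ (of the same arity as $\bar{b}$), $\models\phi[\bar{c},\bar{b}']$ implies that $\mathrm{tp}(\bar{c}/A\bar{b}')$ forks over $A$. *)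

(* Defs.v *)
From HB Require Import structures.
From mathcomp Require Import all_boot.
From mathcomp Require Import boolp classical_sets functions cardinality.

Set Implicit Arguments.
Unset Strict Implicit.
Unset Printing Implicit Defensive.

Local Open Scope classical_set_scope.
Local Open Scope card_scope.

Record language := Language {
  func : Type;
  func_arity : func -> nat;
  rel_symb : Type;
  rel_arity : rel_symb -> nat }.

Inductive term (L : language) (V : Type) : Type :=
| Var of V
| App (f : func L) of ('I_(func_arity f) -> term L V).

(* Formulas whose free variables are taken in V.  The variable bound by All is
   None; the other connectives are classically definable from these. *)
Inductive formula (L : language) (V : Type) : Type :=
| Bot
| Equal of term L V & term L V
| Rel (r : rel_symb L) of ('I_(rel_arity r) -> term L V)
| Imp of formula L V & formula L V
| All of formula L (option V).

Arguments Var {L V} _.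
Arguments App {L V} f _.
Arguments Bot {L V}.
Arguments Equal {L V} _ _.
Arguments Rel {L V} r _.
Arguments Imp {L V} _ _.
Arguments All {L V} _.

Definition Not (L : language) (V : Type) (phi : formula L V) := Imp phi Bot.

Notation sentence L := (formula L void).

Record structure (L : language) := Structure {
  dom :> Type;
  dom_inhabited : inhabited dom;
  func_interp : forall f : func L, ('I_(func_arity f) -> dom) -> dom;
  rel_interp : forall r : rel_symb L, ('I_(rel_arity r) -> dom) -> Prop }.

Arguments func_interp {L} s f _.
Arguments rel_interp {L} s r _.

Fixpoint eval (L : language) (M : structure L) (V : Type) (v : V -> M)
    (t : term L V) : M :=
  match t with
  | Var x => v x
  | App f ts => func_interp M f (fun i => eval v (ts i))
  end.

Fixpoint sat (L : language) (M : structure L) (V : Type) (v : V -> M)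
    (phi : formula L V) : Prop :=
  match phi with
  | Bot => False
  | Equal t u => eval v t = eval v u
  | Rel r ts => rel_interp M r (fun i => eval v (ts i))
  | Imp phi psi => sat v phi -> sat v psi
  | All phi => forall a : M, sat (fun x : option V => oapp v a x) phi
  end.

Definition models (L : language) (M : structure L) (T : set (sentence L)) :=
  forall sigma, T sigma -> sat (of_void M) sigma.

Definition consequence (L : language) (T : set (sentence L))
    (sigma : sentence L) :=
  forall M : structure L, models M T -> sat (of_void M) sigma.

Definition complete_theory (L : language) (T : set (sentence L)) :=
  (exists M : structure L, models M T) /\
  (forall sigma, consequence T sigma \/ consequence T (Not sigma)).

(* Combining valuations: pairv u v reads the variables of U through u and those
   of V through v. *)
Definition pairv (U V M : Type) (u : U -> M) (v : V -> M) (x : U + V) : M :=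
  match x with inl i => u i | inr j => v j end.

(* A finite tuple of M is a map 'I_n -> M.  A formula over a set A of
   parameters, with free variables in V, is a formula with variables in V + A
   (A being coerced to a type), each a in A being interpreted by itself. *)
Definition formula_over (L : language) (M : structure L) (A : set M)
    (V : Type) : Type := formula L (V + A)%type.

Definition sat_over (L : language) (M : structure L) (A : set M) (V : Type)
    (v : V -> M) (phi : formula_over A V) : Prop :=
  sat (pairv v (fun a : A => \val a)) phi.

Definition tp (L : language) (M : structure L) (A : set M) (n : nat)
    (c : 'I_n -> M) : set (formula_over A 'I_n) :=
  [set phi | sat_over c phi].

Arguments tp {L M} A {n} c _.

Definition finitely_satisfiable (L : language) (M : structure L) (A : set M)
    (n : nat) (p : set (formula_over A 'I_n)) :=
  forall q : set (formula_over A 'I_n), finite_set q -> q `<=` p ->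
    exists c : 'I_n -> M, forall phi, q phi -> sat_over c phi.

(* Cardinals are represented by types: |A| < |K|. *)
Definition card_lt (U : Type) (A : set U) (K : Type) :=
  A #<= [set: K] /\ ~ ([set: K] #<= A).

Definition saturated (L : language) (K : Type) (M : structure L) :=
  forall (A : set M) (n : nat) (p : set (formula_over A 'I_n)),
    card_lt A K -> finitely_satisfiable p ->
    exists c : 'I_n -> M, forall phi, p phi -> sat_over c phi.

Definition automorphism (L : language) (M : structure L) (s : M -> M) :=
  [/\ bijective s,
      (forall f args,
         s (func_interp M f args) = func_interp M f (fun i => s (args i))) &
      (forall r args,
         rel_interp M r args <-> rel_interp M r (fun i => s (args i)))].

(* Only the values of f on A matter. *)
Definition partial_elementary (L : language) (M : structure L) (A : set M)
    (f : M -> M) :=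
  forall phi : formula L A,
    sat (fun a : A => \val a) phi <-> sat (fun a : A => f (\val a)) phi.

Definition strongly_homogeneous (L : language) (K : Type) (M : structure L) :=
  forall (A : set M) (f : M -> M),
    card_lt A K -> partial_elementary A f ->
    exists s : M -> M, automorphism s /\ {in A, s =1 f}.

(* The first clause says that |K| > |L| + aleph_0. *)
Definition monster_model (L : language) (K : Type) (T : set (sentence L))
    (C : structure L) :=
  [/\ card_lt [set: nat + (func L + rel_symb L)] K,
      models C T,
      saturated K C &
      strongly_homogeneous K C].

(* The family of instances phi(x, a_i), i < omega, is k-inconsistent. *)
Definition k_inconsistent (L : language) (C : structure L) (n m : nat)
    (phi : formula L ('I_n + 'I_m)) (k : nat) (a : nat -> 'I_m -> C) :=
  forall i : 'I_k -> nat, {homo i : l1 l2 / l1 < l2} ->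
    ~ exists d : 'I_n -> C, forall l, sat (pairv d (a (i l))) phi.

Definition divides (L : language) (C : structure L) (A : set C) (n m : nat)
    (phi : formula L ('I_n + 'I_m)) (a : 'I_m -> C) :=
  exists (k : nat) (a_ : nat -> 'I_m -> C),
    (forall i, tp A (a_ i) = tp A a) /\ k_inconsistent phi k a_.

(* p is a type over some set B.  That p entails the disjunction means that
   finitely many formulas of p imply it in C. *)
Definition forks (L : language) (C : structure L) (A B : set C) (n : nat)
    (p : set (formula_over B 'I_n)) :=
  exists (r : nat) (m : 'I_r -> nat)
         (phi : forall l : 'I_r, formula L ('I_n + 'I_(m l)))
         (a : forall l : 'I_r, 'I_(m l) -> C),
    (forall l, divides A (phi l) (a l)) /\
    exists q : set (formula_over B 'I_n),
      [/\ finite_set q, q `<=` p &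
          forall d : 'I_n -> C, (forall psi, q psi -> sat_over d psi) ->
            exists l, sat (pairv d (a l)) (phi l)].

(* Finite sequences s of naturals index the nodes of the tree; mkseq eta j is
   the restriction of eta to j.  A set of formulas is consistent when each of
   its finite subsets is satisfiable in C. *)
Definition tree_property (L : language) (C : structure L) (n m : nat)
    (phi : formula L ('I_n + 'I_m)) :=
  exists (k : nat) (a : seq nat -> 'I_m -> C),
    [/\ 2 <= k,
        (forall s, k_inconsistent phi k (fun i => a (rcons s i))) &
        (forall (eta : nat -> nat) (J : set nat),
           finite_set J -> J `<=` [set j | 1 <= j] ->
           exists d : 'I_n -> C,
             forall j, J j -> sat (pairv d (a (mkseq eta j))) phi)].

(* Simplicity of the theory of C, tested in C. *)
Definition simple (L : language) (C : structure L) :=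
  forall (n m : nat) (phi : formula L ('I_n + 'I_m)), ~ tree_property C phi.

Definition dual_finite_character (L : language) (K : Type) (C : structure L) :=
  forall (A : set C) (m n : nat) (b : 'I_m -> C) (c : 'I_n -> C),
    card_lt A K ->
    forks A (tp (A `|` range b) c) ->
    exists phi : formula_over A ('I_n + 'I_m),
      sat_over (pairv c b) phi /\
      forall b' : 'I_m -> C, sat_over (pairv c b') phi ->
        forks A (tp (A `|` range b') c).

(* Main.v *)
Require Import Defs.
From mathcomp Require Import all_boot.
From mathcomp Require Import boolp classical_sets functions cardinality.

(* It suffices to prove that nonforking is symmetric: if tp(c/Ab) forks over A,
   then tp(b/Ac) forks over A, hence contains a formula phi(c,y) over A which
   forks over A, and any b' with phi(c,b') makes tp(b'/Ac), hence tp(c/Ab'),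
   fork over A.

   No indiscernible sequences are used.  Fix finitely many formulas
   R_l(x,y) and k.  A set P of tuples has rank >= N+1 when some R_l has a
   k-inconsistent family of instances R_l(x,a_j), j < omega, such that every
   P /\ R_l(x,a_j) has rank >= N.  Unbounded rank would give, by compactness, a
   formula with the tree property, so simplicity bounds the rank.
   - If P is covered by finitely many sets then one of its pieces keeps its
     rank (pigeonhole), while P is invariant over A; so a forking cover of P
     would increase its rank, and no type forks over its own domain.
   - If R(x,b) k-divides over B and tp(d/Bb) does not fork over A, where A is
     contained in B, then R(x,b) k-divides over Bd (compactness).  Hence along
     a sequence of conjugates b_i of b such that tp(b_i/A b_0 ... b_{i-1}) does
     not fork over A, R(x,b_i) k-divides over A b_{i+1} ... b_{N-1}, and a
     common realization of the R(x,b_i), i < N, gives rank >= N.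
   The second point shows that a forking formula divides (use such a sequence
   of conjugates of b together with the parameters of a forking cover), and
   then symmetry: if tp(b/Ac) does not fork over A, take the b_i conjugate to
   b over Ac. *)

Set Implicit Arguments.
Unset Strict Implicit.
Unset Printing Implicit Defensive.

Local Open Scope classical_set_scope.
Local Open Scope card_scope.

(** * Definable sets *)

Fixpoint term_rename (L : language) (V W : Type) (g : V -> W) (t : term L V) :
    term L W :=
  match t with
  | Var x => Var (g x)
  | App f ts => App f (fun i => term_rename g (ts i))
  end.

Fixpoint rename (L : language) (V W : Type) (g : V -> W) (phi : formula L V) :
    formula L W :=
  match phi with
  | Bot => Bot
  | Equal t u => Equal (term_rename g t) (term_rename g u)
  | Rel r ts => Rel r (fun i => term_rename g (ts i))
  | Imp phi psi => Imp (rename g phi) (rename g psi)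
  | All phi => All (rename (omap g) phi)
  end.

(** * Renaming of variables, and reduction to finitely many variables *)

Section Renaming.
Variables (L : language) (M : structure L).

Lemma eval_rename (V W : Type) (g : V -> W) (v : W -> M) (t : term L V) :
  eval v (term_rename g t) = eval (v \o g) t.
Proof. by elim: t => //= f ts IH; congr func_interp; apply/funext. Qed.

Lemma sat_rename (V W : Type) (g : V -> W) (v : W -> M) (phi : formula L V) :
  sat v (rename g phi) <-> sat (v \o g) phi.
Proof.
elim: phi W g v => //=.
- by move=> {}V t u W g v; rewrite !eval_rename.
- move=> {}V r ts W g v.
  by under [X in rel_interp _ _ X]funext do rewrite eval_rename.
- by move=> {}V phi IHphi psi IHpsi W g v; rewrite IHphi IHpsi.
- move=> {}V phi IH W g v.
  have eqv a : oapp v a \o omap g = oapp (v \o g) a by apply/funext; case.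
  by split=> + a => /(_ a); rewrite IH eqv.
Qed.

(** The supports of the arguments are gathered, as disjoint copies, in one finite sum type; each is
    packed with its term so that [choice] applies. *)
Lemma family_finite_support (V : Type) n (ts : 'I_n -> term L V) :
  (forall i, exists (W : finType) (p : W -> V) (t' : term L W),
     forall v : V -> M, eval v (ts i) = eval (v \o p) t') ->
  exists (W : finType) (p : W -> V) (ts' : 'I_n -> term L W),
    forall (v : V -> M) i, eval v (ts i) = eval (v \o p) (ts' i).
Proof.
move=> H; have /choice[F HF] : forall i,
    exists F : {W : finType & ((W -> V) * term L W)%type},
    forall v : V -> M, eval v (ts i) = eval (v \o (tagged F).1) (tagged F).2.
  move=> i; have [W [p [t' E]]] := H i.
  by exists (existT (fun W : finType => ((W -> V) * term L W)%type) W (p, t')).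
exists {i : 'I_n & tag (F i)}.
exists (fun x => (tagged (F (tag x))).1 (tagged x)).
exists (fun i => term_rename (fun w => Tagged (fun i => tag (F i)) w)
                   (tagged (F i)).2) => v i.
by rewrite HF eval_rename.
Qed.

Lemma term_finite_support (V : Type) (t : term L V) :
  exists (W : finType) (p : W -> V) (t' : term L W),
    forall v : V -> M, eval v t = eval (v \o p) t'.
Proof.
elim: t => [x|f ts IH]; first by exists unit, (fun=> x), (Var tt).
have [W [p [ts' E]]] := family_finite_support IH.
by exists W, p, (App f ts') => v /=; congr func_interp; apply/funext => i.
Qed.

(** Variable types may be infinite. Confining each formula to finitely many variables is what allows
    quantification over infinite tuples and the limit step of compactness. *)
Lemma formula_finite_support (V : Type) (phi : formula L V) :
  exists (W : finType) (p : W -> V) (phi' : formula L W),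
    forall v : V -> M, sat v phi <-> sat (v \o p) phi'.
Proof.
elim: phi => {V} [V|V t u|V r ts|V phi IHphi psi IHpsi|V phi IH].
- by exists void, (of_void V), Bot.
- have [W [p [t' Et]]] := term_finite_support t.
  have [W' [p' [u' Eu]]] := term_finite_support u.
  exists (W + W')%type, (pairv p p').
  exists (Equal (term_rename inl t') (term_rename inr u')) => v /=.
  by rewrite Et Eu !eval_rename.
- have [W [p [ts' E]]] :=
    family_finite_support (fun i => term_finite_support (ts i)).
  exists W, p, (Rel r ts') => v /=.
  by under [X in rel_interp _ _ X]funext do rewrite E.
- have [W [p [phi' E]]] := IHphi; have [W' [p' [psi' E']]] := IHpsi.
  exists (W + W')%type, (pairv p p').
  exists (Imp (rename inl phi') (rename inr psi')) => v /=.
  by rewrite E E' !sat_rename.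
(* The support of the body may contain the bound variable [None]. Such entries are sent to an
   arbitrary [x0], whose value is never read; if [V] is empty there is no [x0], but then [void]
   itself serves as support. *)
- have [V0|nV] := pselect (inhabited V); last first.
    have g (x : V) : void by case: nV.
    exists void, (of_void V), (rename g (All phi)) => v.
    rewrite sat_rename (_ : (v \o _) \o g = v)//.
    by apply/funext => x; case: nV.
  case: V0 => x0; have [W [p [phi' E]]] := IH.
  exists W, (odflt x0 \o p).
  exists (All (rename (fun w => if p w is None then None else Some w) phi')).
  move=> v /=; have eqv a : oapp (v \o (odflt x0 \o p)) a \o
      (fun w => if p w is None then None else Some w) = oapp v a \o p.
    by apply/funext => w /=; case pw: (p w) => [x|] //=; rewrite pw.
  by split=> + a => /(_ a); rewrite E sat_rename eqv.
Qed.

End Renaming.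

Lemma pairvE (U V M : Type) (v : U + V -> M) : v = pairv (v \o inl) (v \o inr).
Proof. by apply/funext; case. Qed.

(** * Closure properties of relations definable over a set *)

Section Definability.
Variables (L : language) (C : structure L).
Implicit Types A B : set C.

Definition definable A (V : Type) (P : (V -> C) -> Prop) :=
  exists phi : formula_over A V, forall v, P v <-> sat_over v phi.

Definition definable2 A (X Y : Type) (R : (X -> C) -> (Y -> C) -> Prop) :=
  definable A (fun v : X + Y -> C => R (v \o inl) (v \o inr)).

Notation params A := (fun a : A => \val a : C).

Lemma definable_ext A V (P Q : (V -> C) -> Prop) :
  (forall v, P v <-> Q v) -> definable A P -> definable A Q.
Proof. by move=> PQ [phi E]; exists phi => v; rewrite -PQ. Qed.

(** [g] replaces each variable by a variable or by a parameter, so this one substitution covers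
    renaming, enlarging the parameter set and plugging in parameters. *)
Lemma definable_comp A B (V V' : Type) (g : V -> V' + B)
    (P : (V -> C) -> Prop) :
  A `<=` B -> definable A P ->
  definable B (fun v => P (pairv v (params B) \o g)).
Proof.
move=> AB [phi E].
pose h (x : V + A) : V' + B :=
  match x with
  | inl y => g y
  | inr a => inr (SigSub (mem_set (AB _ (set_mem (valP a)))))
  end.
exists (rename h phi) => v; rewrite E /sat_over sat_rename.
have -> : pairv v (params B) \o h =
  pairv (pairv v (params B) \o g) (params A)
  by apply/funext; case.
by [].
Qed.

Lemma definable_rename A (V V' : Type) (g : V -> V') (P : (V -> C) -> Prop) :
  definable A P -> definable A (fun v => P (v \o g)).
Proof. exact: (@definable_comp A A V V' (fun x => inl (g x))). Qed.

Lemma definable_sub A B V (P : (V -> C) -> Prop) :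
  A `<=` B -> definable A P -> definable B P.
Proof. exact: (@definable_comp A B V V inl). Qed.

Lemma definable_false A V : definable A (fun _ : V -> C => False).
Proof. by exists Bot. Qed.

Lemma definable_imp A V (P Q : (V -> C) -> Prop) :
  definable A P -> definable A Q -> definable A (fun v => P v -> Q v).
Proof.
move=> [phi E] [psi E']; exists (Imp phi psi) => v.
by rewrite E E'.
Qed.

Lemma definable_not A V (P : (V -> C) -> Prop) :
  definable A P -> definable A (fun v => ~ P v).
Proof. by move=> dP; apply: definable_imp => //; apply: definable_false. Qed.

Lemma definable_and A V (P Q : (V -> C) -> Prop) :
  definable A P -> definable A Q -> definable A (fun v => P v /\ Q v).
Proof.
move=> dP dQ; apply: (@definable_ext _ _ (fun v => ~ (P v -> ~ Q v))) => [v|].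
  by rewrite not_implyE notK.
by apply: definable_not; apply: definable_imp => //; apply: definable_not.
Qed.

Lemma definable_const A V (P : Prop) : definable A (fun _ : V -> C => P).
Proof.
have [p|np] := pselect P; last first.
  by apply: definable_ext (definable_false _ _) => v; tauto.
by apply: definable_ext (definable_not (definable_false A V)) => v; tauto.
Qed.

Lemma definable_forall_fin A V (I : finType) (P : I -> (V -> C) -> Prop) :
  (forall i, definable A (P i)) -> definable A (fun v => forall i, P i v).
Proof.
move=> dP.
suff H (s : seq I) : definable A (fun v => forall i, i \in s -> P i v).
  apply: definable_ext (H (enum I)) => v; split=> + i; last by [].
  by move=> /(_ i); apply; rewrite mem_enum.
elim: s => [|i s IH].
  by apply: definable_ext (definable_const A V True) => v.
apply: definable_ext (definable_and (dP i) IH) => v; split.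
  by move=> [Pi Ps] j; rewrite inE => /orP[/eqP->//|/Ps].
by move=> H; split=> [|j js]; apply: H; rewrite inE ?eqxx ?js ?orbT.
Qed.

Lemma definable_eq A V (x y : V) : definable A (fun v : V -> C => v x = v y).
Proof. by exists (Equal (Var (inl x)) (Var (inl y))). Qed.

Lemma definable_exists_option A V (P : (option V -> C) -> Prop) :
  definable A P -> definable A (fun v => exists a, P (oapp v a)).
Proof.
move=> [phi E].
pose g (x : option V + A) : option (V + A) :=
  match x with
  | inl None => None | inl (Some y) => Some (inl y) | inr a => Some (inr a)
  end.
have H v a : sat (oapp (pairv v (params A)) a) (rename g phi) <-> P (oapp v a).
  rewrite sat_rename E /sat_over.
  have -> // : oapp (pairv v (params A)) a \o g = pairv (oapp v a) (params A).
  by apply/funext; case=> [[]|].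
exists (Imp (All (Imp (rename g phi) Bot)) Bot) => v.
rewrite /sat_over /=; split.
  by move=> [a Pa] /(_ a); apply; apply/H.
by move=> nP; apply: contrapT => nE; apply: nP => a /H Pa; apply: nE; exists a.
Qed.

Lemma definable_exists_ord A V n (P : ('I_n + V -> C) -> Prop) :
  definable A P -> definable A (fun v => exists w, P (pairv w v)).
Proof.
elim: n V P => [|n IH] V P dP.
  pose g (x : 'I_0 + V) : V :=
    match x with inl i => match notF (ltn_ord i) with end | inr y => y end.
  have gE (T : Type) (v : V -> T) w : v \o g = pairv w v.
    by apply/funext; case=> // -[].
  apply: definable_ext (definable_rename g dP) => v.
  have w0 : 'I_0 -> C by case.
  by split=> [Pv|[w]]; [exists w0; rewrite -(gE _ _ w0)|rewrite -(gE _ _ w)].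
pose g (x : 'I_n.+1 + V) : 'I_n + option V :=
  match x with
  | inl i => if unlift ord0 i is Some j then inl j else inr None
  | inr y => inr (Some y)
  end.
apply: definable_ext (definable_exists_option (IH _ _ (definable_rename g dP))).
move=> v; split=> [[a [w Pw]]|[w Pw]].
  exists (fun i => if unlift ord0 i is Some j then w j else a).
  congr P: Pw; apply/funext; case=> //= i.
  by case: (unlift ord0 i).
exists (w ord0), (w \o lift ord0).
congr P: Pw; apply/funext; case=> //= i.
by case: unliftP => [j ->|->].
Qed.

Lemma definable_exists_fin A V (W : finType) (P : (W + V -> C) -> Prop) :
  definable A P -> definable A (fun v => exists w, P (pairv w v)).
Proof.
move=> dP.
pose g (x : W + V) : 'I_#|W| + V :=
  match x with inl i => inl (enum_rank i) | inr y => inr y end.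
apply: definable_ext (definable_exists_ord (definable_rename g dP)) => v.
split=> -[w Pw]; [exists (w \o enum_rank)|exists (w \o enum_val)];
  congr P: Pw; apply/funext; case=> //= i.
by rewrite enum_rankK.
Qed.

(** Although [W] may be infinite, the formula reads only finitely many variables, so quantifying
    over a finite tuple suffices. *)
Lemma definable_exists A V (W : Type) (P : (W + V -> C) -> Prop) :
  definable A P -> definable A (fun v => exists w, P (pairv w v)).
Proof.
move=> [phi E].
have [D [p [psi E']]] := formula_finite_support C phi.
(* Distinct elements of the support may name the same variable of [W]; [rep] picks one of them for
   all, so that they receive the same value. *)
pose rep (x : W + V + A) (d : D) := odflt d [pick d' | `[<p d' = x>]].
pose g (d : D) : (D + V) + A :=
  match p d with
  | inl (inl w) => inl (inl (rep (p d) d))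
  | inl (inr y) => inl (inr y)
  | inr a => inr a
  end.
have dQ : definable A (fun v => exists u : D -> C,
    sat (pairv (pairv u v) (params A) \o g) psi).
  apply: (@definable_exists_fin _ _ _
            (fun u => sat (pairv u (params A) \o g) psi)).
  by exists (rename g psi) => v; rewrite /sat_over sat_rename.
apply: definable_ext dQ => v; have [c0] := dom_inhabited C.
split=> -[u].
  move=> Pu; pose w x :=
    if [pick d | `[<p d = inl (inl x)>]] is Some d then u d else c0.
  exists w; rewrite E /sat_over E'; congr sat: Pu.
  apply/funext => d; rewrite /= /g /rep; case pd : (p d) => [[x|y]|a] //=.
  rewrite /w; case: pickP => [//|/(_ d)/negP[]].
  exact/asboolP.
rewrite E /sat_over E' => Pu.
exists (fun d => if p d is inl (inl x) then u x else c0).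
congr sat: Pu; apply/funext => d; rewrite /= /g.
case pd : (p d) => [[x|y]|a] //=.
rewrite /rep; case: pickP => [d' /asboolP->//|/(_ d)/negP[]].
exact/asboolP.
Qed.

End Definability.

(** * Small sets *)

Lemma injective_card_le T U (A : set T) (B : set U) (f : T -> U) :
  {in A &, injective f} -> (forall x, A x -> B (f x)) -> A #<= B.
Proof.
move=> injf AB; rewrite -(card_le_eql (inj_card_eq injf)).
by apply: subset_card_le => _ [x Ax <-]; apply: AB.
Qed.

(** Hilbert's hotel: for an injection [g] of the naturals into [A], the new point moves to [g 0],
    each [g n] to [g n.+1], and all other points stay. *)
Lemma infinite_setU1_card_le T (A : set T) (x : T) :
  infinite_set A -> A `|` [set x] #<= A.
Proof.
move=> /infiniteP/card_leP[g'].
have [Ax|nAx] := pselect (A x).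
  by apply: subset_card_le => y [//|->].
pose g n := \val (g' (SigSub (in_setT n))).
have gA n : A (g n) by apply: set_mem; apply: valP.
have g_inj m n : g m = g n -> m = n.
  by move=> /val_inj/(inj (f := g'))-/(_ (in_setT _) (in_setT _))/(congr1 val).
have /choice[f Hf] : forall y, exists z,
    [/\ y = x -> z = g 0, forall n, y = g n -> z = g n.+1 &
        y <> x -> (forall n, y <> g n) -> z = y].
  move=> y; have [->|nyx] := pselect (y = x).
    by exists (g 0); split=> // n E; case: nAx; rewrite E.
  have [[n ->]|ng] := pselect (exists n, y = g n).
    exists (g n.+1); split=> [E|m /g_inj->//|_ /(_ n)//].
    by case: nAx; rewrite -E.
  by exists y; split=> // n E; case: ng; exists n.
have f_case y : (y = x /\ f y = g 0) \/ (exists n, y = g n /\ f y = g n.+1) \/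
    (forall n, y <> g n) /\ f y = y.
  have [H0 H1 H2] := Hf y.
  have [E|nyx] := pselect (y = x); first by left; split; [|apply: H0].
  have [[n E]|ng] := pselect (exists n, y = g n).
    by right; left; exists n; split; [|apply: H1].
  right; right; have ng' n : y <> g n by move=> E; case: ng; exists n.
  by split => //; apply: H2.
apply: (@injective_card_le _ _ _ _ f) => [y z _ _|y Ay].
  case: (f_case y) => [[-> ->]|[[n [-> ->]]|[ny ->]]];
    case: (f_case z) => [[-> ->]|[[m [-> ->]]|[nz ->]]] //.
  - by move=> /g_inj.
  - by move=> /esym/nz.
  - by move=> /g_inj.
  - by move=> /g_inj[->].
  - by move=> /esym/nz.
  - by move=> /ny.
  - by move=> /ny.
case: (f_case y) => [[_ ->]|[[n [_ ->]]|[_ fy]]] //.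
case: Ay => [|E]; rewrite fy //.
by case: (Hf y) => /(_ E) Hy _ _; rewrite -fy Hy.
Qed.

Lemma card_lt_setU1 T (A : set T) (x : T) (K : Type) :
  [set: nat] #<= [set: K] -> card_lt A K -> card_lt (A `|` [set x]) K.
Proof.
move=> K_inf [AK nKA].
have [Afin|Ainf] := pselect (finite_set A).
  have AxF : finite_set (A `|` [set x]).
    by rewrite finite_setU; split => //; apply: finite_set1.
  split; last by move=> /card_le_finite/(_ AxF); apply/infiniteP.
  have [n An] := (finite_set_leP _).1 AxF.
  by apply: card_le_trans K_inf; apply: card_le_trans An (subset_card_le _).
have AxA := infinite_setU1_card_le x Ainf; split.
  exact: card_le_trans AK.
by move=> KAx; apply: nKA; apply: card_le_trans AxA.
Qed.

Lemma card_lt_setU_range T (A : set T) (W : finType) (e : W -> T) (K : Type) :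
  [set: nat] #<= [set: K] -> card_lt A K -> card_lt (A `|` range e) K.
Proof.
move=> K_inf AK.
suff H (s : seq W) : card_lt (A `|` [set e w | w in [set` s]]) K.
  rewrite (_ : range e = [set e w | w in [set` enum W]]) //.
  by apply/seteqP; split=> _ [w _ <-]; exists w => //=; rewrite mem_enum.
elim: s => [|w s IH].
  rewrite (_ : [set` [::]] = set0) ?image_set0 ?setU0 //.
  by apply/seteqP; split.
rewrite (_ : _ `|` _ = A `|` [set e w | w in [set` s]] `|` [set e w]).
  exact: card_lt_setU1.
apply/seteqP; split=> x.
  move=> [Ax|[y /=]]; first by left; left.
  by rewrite inE => /orP[/eqP->|ys] <-; [right|left; right; exists y].
by move=> [[Ax|[y ys <-]]|->]; [left|right; exists y|right; exists w] => //=;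
  rewrite inE ?ys ?eqxx ?orbT.
Qed.

(** * Homogeneity and compactness *)

Lemma finite_set_directed T I (S : T -> I -> Prop) (q : set T) (i0 : I) :
  finite_set q -> (forall x, q x -> exists i, S x i) ->
  (forall i j, exists k, forall x, S x i \/ S x j -> S x k) ->
  exists i, forall x, q x -> S x i.
Proof.
move=> /(finite_seqP (q : set {classic T})).1[s ->] qS dir.
have {qS} : forall x : {classic T}, x \in s -> exists i, S x i by [].
elim: s => [_|x s IH sS]; first by exists i0.
have [|i Hi] := IH; first by move=> y ys; apply: sS; rewrite inE ys orbT.
have [|j Hj] := sS x; first by rewrite inE eqxx.
have [k Hk] := dir i j; exists k => y /=; rewrite inE => /orP[/eqP->|ys].
  by apply: Hk; right.
by apply: Hk; left; apply: Hi.
Qed.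

Section Saturation.
Variables (L : language) (K : Type) (C : structure L).
Hypothesis infinite_K : [set: nat] #<= [set: K].
Hypothesis saturated_C : saturated K C.
Hypothesis homogeneous_C : strongly_homogeneous K C.
Implicit Types A B : set C.

Notation small A := (card_lt A K).
Notation params A := (fun a : A => \val a : C).

(** One implication suffices, since definable sets are closed under complement. Unlike in [tp], the
    tuples may be infinite. *)
Definition eqtp A (V : Type) (a a' : V -> C) :=
  forall P, definable A P -> P a -> P a'.

Lemma eqtp_sym A V (a a' : V -> C) : eqtp A a a' -> eqtp A a' a.
Proof.
move=> aa' P dP Pa'; apply: contrapT => nPa.
exact: (aa' _ (definable_not dP) nPa Pa').
Qed.

Lemma eqtp_trans A V (a a' a'' : V -> C) :
  eqtp A a a' -> eqtp A a' a'' -> eqtp A a a''.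
Proof. by move=> aa' a'a'' P dP /(aa' _ dP)/(a'a'' _ dP). Qed.

Lemma eqtp_sub A B V (a a' : V -> C) : A `<=` B -> eqtp B a a' -> eqtp A a a'.
Proof. by move=> AB aa' P dP; apply: aa'; apply: definable_sub dP. Qed.

Lemma eqtp_comp A V W (h : W -> V) (a a' : V -> C) :
  eqtp A a a' -> eqtp A (a \o h) (a' \o h).
Proof.
by move=> aa' P /(definable_rename h) dP Pa; exact: (aa' _ dP Pa).
Qed.

Lemma tp_eqtp A n (a a' : 'I_n -> C) : tp A a = tp A a' <-> eqtp A a a'.
Proof.
split=> [E P [phi Ephi]|aa'].
  by rewrite !Ephi -[_ a phi]/(tp A a phi) E.
have dphi (phi : formula_over A 'I_n) : definable A (fun v => sat_over v phi).
  by exists phi.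
by apply/seteqP; split=> phi; [exact: (aa' _ (dphi phi))|
                               exact: (eqtp_sym aa' (dphi phi))].
Qed.

Definition fixing_automorphism A (s : C -> C) :=
  automorphism s /\ forall x, A x -> s x = x.

Lemma fixing_automorphism_sub A B s :
  A `<=` B -> fixing_automorphism B s -> fixing_automorphism A s.
Proof. by move=> AB [sa sB]; split=> // x /AB/sB. Qed.

Lemma automorphism_sat s V (v : V -> C) (phi : formula L V) :
  automorphism s -> sat v phi <-> sat (s \o v) phi.
Proof.
move=> [sbij sf sr].
have sE W (w : W -> C) t : eval (s \o w) t = s (eval w t).
  by elim: t => //= f ts IH; rewrite sf; congr func_interp; apply/funext.
elim: phi v => //=.
- by move=> {}V t u v; rewrite !sE; split=> [->//|/(bij_inj sbij)].
- move=> {}V r ts v; rewrite sr.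
  by under [X in _ <-> rel_interp _ _ X]funext do rewrite sE.
- by move=> {}V phi IHphi psi IHpsi v; rewrite IHphi IHpsi.
- move=> {}V phi IH v.
  have sv a : s \o oapp v a = oapp (s \o v) (s a) by apply/funext; case.
  case: sbij => t sK tK; split=> + a; last first.
    by move=> /(_ (s a)); rewrite -sv -IH.
  by move=> /(_ (t a)); rewrite IH sv tK.
Qed.

Lemma fixing_automorphism_definable A s V (P : (V -> C) -> Prop) v :
  fixing_automorphism A s -> definable A P -> P v <-> P (s \o v).
Proof.
move=> [sa sA] [phi E]; rewrite !E /sat_over (automorphism_sat _ _ sa).
have -> // : s \o pairv v (params A) = pairv (s \o v) (params A).
apply/funext; case=> //= a; apply: sA; exact: set_mem (valP a).
Qed.

Lemma fixing_automorphism_eqtp A s V (v : V -> C) :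
  fixing_automorphism A s -> eqtp A v (s \o v).
Proof. by move=> sA P dP; rewrite (fixing_automorphism_definable v sA dP). Qed.

(** Equalities among the entries, and with elements of [A], are part of the type, so fixing [A] and
    sending [a] to [a'] is well defined. This map is elementary because the types agree, and strong
    homogeneity extends it. *)
Lemma eqtp_automorphism A (W : finType) (a a' : W -> C) :
  small A -> eqtp A a a' -> exists2 s, fixing_automorphism A s & s \o a = a'.
Proof.
move=> sA aa'.
have /choice[f Hf] : forall x, exists y,
    (A x -> y = x) /\ (forall w, x = a w -> y = a' w).
  move=> x; have [Ax|nAx] := pselect (A x).
    exists x; split=> // w xw; symmetry.
    apply: (aa' (fun v => v w = x)) => //.
    by exists (Equal (Var (inl w)) (Var (inr (SigSub (mem_set Ax))))).
  have [[w xw]|nw] := pselect (exists w, x = a w); last first.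
    by exists x; split=> // w xw; case: nw; exists w.
  exists (a' w); split=> // w' xw'.
  by apply: (aa' (fun v => v w = v w')); [exact: definable_eq|rewrite -xw].
have /choice[h Hh] : forall b : A `|` range a, exists y,
    pairv a (params A) y = \val b.
  move=> [b /= bm]; have [Ab|[w _ <-]] := set_mem bm; last by exists (inl w).
  by exists (inr (SigSub (mem_set Ab))).
have fh (b : A `|` range a) : f (\val b) = pairv a' (params A) (h b).
  have := Hh b; case: (h b) => [w|c] /= <-; first exact: (Hf _).2.
  by apply: (Hf _).1; apply: set_mem (valP c).
have [|s [sa sf]] := homogeneous_C
    (card_lt_setU_range a infinite_K sA) (f := f).
  move=> phi.
  rewrite (_ : (fun b => \val b) = pairv a (params A) \o h); last first.
    by apply/funext => b; rewrite -Hh.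
  rewrite (_ : (fun b => f (\val b)) = pairv a' (params A) \o h); last first.
    by apply/funext => b; rewrite fh.
  have dP : definable A (fun v => sat (pairv v (params A) \o h) phi).
    by exists (rename h phi) => v; rewrite /sat_over sat_rename.
  by split; [exact: (aa' _ dP)|exact: (eqtp_sym aa' dP)].
exists s; first split=> // x Ax.
  by rewrite sf ?inE; [exact: (Hf x).1|left].
apply/funext => w /=; rewrite sf ?inE; first exact: (Hf _).2.
by right; exists w.
Qed.

Lemma definable_bounded A (P : (nat -> C) -> Prop) : definable A P ->
  exists N, forall v v', (forall x, x < N -> v x = v' x) -> P v -> P v'.
Proof.
move=> [phi E]; have [W [p [phi' E']]] := formula_finite_support C phi.
pose m w := if p w is inl x then x.+1 else 0.
exists (\max_w m w) => v v' vv'; rewrite !E /sat_over !E'.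
have -> // : pairv v (params A) \o p = pairv v' (params A) \o p.
apply/funext => w /=; case pw: (p w) => [x|//] /=; apply: vv'.
by have := @leq_bigmax _ m w; rewrite {1}/m pw.
Qed.

(** * Compactness for conditions in countably many variables, from saturation *)

Section Compactness.
Variables (A : set C) (I : Type) (i0 : I).
Hypothesis smallA : small A.

(* The variables are realized one at a time: saturation extends a finite partial
   solution compatible with every P i by one value, and in the limit each P i
   holds because it depends on finitely many variables. *)
Lemma compactness_nat (P : I -> (nat -> C) -> Prop) :
  (forall i, definable A (P i)) ->
  (forall i j, exists k, forall v, P k v -> P i v /\ P j v) ->
  (forall i, exists v, P i v) -> exists v, forall i, P i v.
Proof.
move=> dP dirP satP; have [c0] := dom_inhabited C.
(* Each condition separately has a solution that starts with [s]. *)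
pose inv (s : seq C) := forall i, exists2 v, P i v &
  forall x, x < size s -> v x = nth c0 s x.
have /choice[f Hf] : forall s, exists c, inv s -> inv (rcons s c).
  move=> s; have [Is|nIs] := pselect (inv s); last by exists c0.
  pose n := size s; pose e (x : 'I_n) := nth c0 s x.
  pose B := A `|` range e.
  pose D i (u : 'I_1 -> C) := exists v,
    [/\ P i v, forall x : 'I_n, v x = e x & v n = u ord0].
  have dD i : definable B (D i).
    have dPi : definable B (fun z : nat + 'I_1 -> C => P i (z \o inl)).
      by apply: (@definable_rename _ _ B); apply: definable_sub (dP i); left.
    have de : definable B (fun z : nat + 'I_1 -> C =>
        forall x : 'I_n, z (inl (x : nat)) = e x).
      apply: definable_forall_fin => x.
      have ex : B (e x) by right; exists x.
      by exists (Equal (Var (inl (inl (x : nat))))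
                       (Var (inr (SigSub (mem_set ex))))).
    have dn := @definable_eq _ _ B (nat + 'I_1)%type (inl n) (inr ord0).
    apply: definable_ext
      (definable_exists (definable_and dPi (definable_and de dn))) => u.
    split=> [[v [Pv [v1 v2]]]|[v [Pv v1 v2]]]; exists v; last by [].
    by split.
  (* All consequences of the projections [D i] to the next variable; as each [D i] is definable over
     [B], a realization of [p] satisfies them all. *)
  pose p : set (formula_over B 'I_1) :=
    [set psi | exists i, forall u, D i u -> sat_over u psi].
  have [|u Hu] := saturated_C (p := p) (card_lt_setU_range e infinite_K smallA).
    move=> q qfin qp.
    have [|i Hi] := finite_set_directed
        (S := fun psi i => forall u, D i u -> sat_over u psi) i0 qfin qp.
      move=> i j; have [k Hk] := dirP i j.
      exists k => psi Hpsi u [v [Pv v1 v2]].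
      have [Pi Pj] := Hk v Pv.
      by case: Hpsi; apply; exists v; split.
    have [v Pv v1] := Is i.
    exists (fun=> v n) => phi /Hi; apply; exists v; split=> // x.
    exact: v1.
  exists (u ord0) => _ i; have [phi E] := dD i.
  have /E[v [Pv v1 v2]] : sat_over u phi by apply: Hu; exists i => w /E.
  exists v => // x; rewrite size_rcons ltnS leq_eqVlt nth_rcons.
  move=> /orP[/eqP->|xs]; first by rewrite ltnn eqxx.
  by rewrite xs (v1 (Ordinal xs)).
pose S n := iter n (fun s => rcons s (f s)) [::].
have sizeS n : size (S n) = n by elim: n => //= n IH; rewrite size_rcons IH.
have invS n : inv (S n).
  by elim: n => [i|n /Hf//]; have [v Pv] := satP i; exists v.
pose v x := nth c0 (S x.+1) x.
have vS n x : x < n -> nth c0 (S n) x = v x.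
  elim: n => // n IH; rewrite ltnS leq_eqVlt => /orP[/eqP->//|xn].
  by rewrite /= nth_rcons sizeS xn IH.
exists v => i; have [N HN] := definable_bounded (dP i).
have [v' Pv' v'S] := invS N i; apply: HN Pv' => x xN.
by rewrite v'S ?sizeS // vS.
Qed.

Lemma compactness (V : countType) (P : I -> (V -> C) -> Prop) :
  (forall i, definable A (P i)) ->
  (forall i j, exists k, forall v, P k v -> P i v /\ P j v) ->
  (forall i, exists v, P i v) -> exists v, forall i, P i v.
Proof.
move=> dP dirP satP; have [c0] := dom_inhabited C.
have [||i|v Pv] := @compactness_nat (fun i v => P i (v \o pickle)).
- by move=> i; apply: definable_rename.
- by move=> i j; have [k Hk] := dirP i j; exists k => v /Hk.
- have [v Pv] := satP i.
  exists (fun n => if unpickle n is Some x then v x else c0).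
  by congr (P i): Pv; apply/funext => x /=; rewrite pickleK.
- by exists (v \o pickle).
Qed.

End Compactness.

(** No directedness is asked of [P]: initial segments of an enumeration of [X] provide it, and each
    of them has bounded height [h]. *)
Lemma compactness_countable A (V X : countType) (P : X -> (V -> C) -> Prop)
    (h : X -> nat) :
  small A -> (forall x, definable A (P x)) ->
  (forall N, exists v, forall x, h x <= N -> P x v) ->
  exists v, forall x, P x v.
Proof.
move=> sA dP satP.
pose Q N v := forall i : 'I_N, if unpickle i is Some x then P x v else True.
have [|i j|N|v Qv] := @compactness A nat 0 sA V Q.
- move=> N; apply: definable_forall_fin => i.
  by case: unpickle => [x|]; [exact: dP|exact: definable_const].
- exists (maxn i j) => v Qv; split=> x.
    exact: (Qv (widen_ord (leq_maxl i j) x)).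
  exact: (Qv (widen_ord (leq_maxr i j) x)).
- pose m (i : 'I_N) := if unpickle i is Some x then h x else 0.
  have [v Hv] := satP (\max_i m i); exists v => i.
  case xi: unpickle => [x|//]; apply: Hv.
  by have := @leq_bigmax _ m i; rewrite {1}/m xi.
exists v => x; have := Qv (pickle x).+1 ord_max.
by rewrite /= pickleK.
Qed.

End Saturation.

(** * The rank of a finite family of formulas *)

Lemma pigeonhole_increasing (J : finType) (f : nat -> J) :
  exists j (g : nat -> nat), {homo g : x y / x < y} /\ forall n, f (g n) = j.
Proof.
have [j Hj] : exists j, forall N, exists n, N <= n /\ f n = j.
  apply: contrapT => /forallNP nH.
  have /choice[b Hb] : forall j, exists N, forall n, N <= n -> f n <> j.
    move=> j; have /existsNP[N HN] := nH j; exists N => n Nn fn.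
    by apply: HN; exists n.
  exact: (Hb (f (\max_j b j)) _ (leq_bigmax _)).
have [h Hh] := choice Hj.
pose g n := iter n (fun m => h m.+1) (h 0).
exists j, g; split; last by case=> [|n]; exact: (Hh _).2.
by apply: homo_ltn => [? ? ?|n]; [exact: ltn_trans|exact: (Hh _).1].
Qed.

Lemma finite_set_nat_bounded (J : set nat) :
  finite_set J -> exists N, forall j, J j -> j <= N.
Proof.
move=> /finite_seqP[s ->]; exists (\max_(j <- s) j) => j /= js.
exact: leq_bigmax_seq.
Qed.

Section BoundedRank.
Variables (L : language) (K : Type) (C : structure L).
Hypothesis infinite_K : [set: nat] #<= [set: K].
Hypothesis saturated_C : saturated K C.
Hypothesis homogeneous_C : strongly_homogeneous K C.
Implicit Types A B : set C.

Notation small A := (card_lt A K).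
Notation params A := (fun a : A => \val a : C).

(** The tree property and dividing concern formulas without parameters, so the finitely many
    parameters from [A] are moved into the tuple on the right. *)
Lemma definable2_finite_params A (X W : Type)
    (R : (X -> C) -> (W -> C) -> Prop) :
  definable2 A R ->
  exists (D : finType) (p : D -> W + A) (theta : formula L (X + D)),
    forall d a, R d a <-> sat (pairv d (pairv a (params A) \o p)) theta.
Proof.
move=> [phi E]; have [D [p [phi' E']]] := formula_finite_support C phi.
pose isparam : pred D := fun d => if p d is inl (inl _) then false else true.
pose D' : finType := {d : D | isparam d}.
pose assoc (z : X + (W + A)) : X + W + A :=
  match z with
  | inl x => inl (inl x) | inr (inl w) => inl (inr w) | inr (inr b) => inr b
  end.
have /choice[q Hq] : forall d : D', exists y, p (\val d) = assoc (inr y).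
  case=> d; rewrite /isparam /=; case: (p d) => [[//|w]|b] _.
    by exists (inl w).
  by exists (inr b).
have /choice[g Hg] : forall d, exists z : X + D', p d =
    assoc (match z with inl x => inl x | inr d' => inr (q d') end).
  move=> d; case pd : (p d) => [[x|w]|b]; first by exists (inl x).
    have Hd : isparam d by rewrite /isparam pd.
    by exists (inr (Sub d Hd)); rewrite -Hq SubK.
  have Hd : isparam d by rewrite /isparam pd.
  by exists (inr (Sub d Hd)); rewrite -Hq SubK.
exists D', q, (rename g phi') => d a.
rewrite sat_rename -[R d a]/(R (pairv d a \o inl) (pairv d a \o inr)).
rewrite E /sat_over E'.
have -> // : pairv (pairv d a) (params A) \o p =
             pairv d (pairv a (params A) \o q) \o g.
apply/funext => x /=; rewrite Hg.
by case: (g x) => //= y; case: (q y).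
Qed.

Lemma eqtp_params A D (W : Type) (p : D -> W + A) (a a' : W -> C) :
  eqtp A a a' ->
  eqtp A (pairv a (params A) \o p) (pairv a' (params A) \o p).
Proof.
move=> aa' P dP.
exact: (aa' (fun a => P (pairv a (params A) \o p)) (definable_comp p _ dP)).
Qed.

(** * Inconsistent families and dividing, with a fixed bound [k] *)

Section Inconsistency.
Variables (X W : Type) (R : (X -> C) -> (W -> C) -> Prop) (k : nat).

Definition inconsistent (a : nat -> W -> C) :=
  forall i : 'I_k -> nat, {homo i : l1 l2 / l1 < l2} ->
    ~ exists d : X -> C, forall l, R d (a (i l)).

Definition kdivides A (a : W -> C) :=
  exists a_ : nat -> W -> C, (forall i, eqtp A a (a_ i)) /\ inconsistent a_.

End Inconsistency.

Lemma inconsistent_leq X W (R : (X -> C) -> (W -> C) -> Prop) k k' a :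
  k <= k' -> inconsistent R k a -> inconsistent R k' a.
Proof.
move=> kk' Ra i ilt [d Rd]; apply: (Ra (i \o widen_ord kk')).
  by move=> x y xy; apply: ilt.
by exists d => l; apply: Rd.
Qed.

Lemma inconsistent_imply X X' W W' (R : (X -> C) -> (W -> C) -> Prop)
    (R' : (X' -> C) -> (W' -> C) -> Prop) (h : (X' -> C) -> X -> C) k a a' :
  (forall d j, R' d (a' j) -> R (h d) (a j)) ->
  inconsistent R k a -> inconsistent R' k a'.
Proof.
move=> RR' Ra i ilt [d R'd]; apply: (Ra i ilt).
by exists (h d) => l; apply: RR'.
Qed.

Lemma inconsistent_subseq X W (R : (X -> C) -> (W -> C) -> Prop) k a g :
  {homo g : x y / x < y} -> inconsistent R k a -> inconsistent R k (a \o g).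
Proof.
move=> glt Ra i ilt; apply: (Ra (g \o i)) => x y xy /=.
by apply: glt; apply: ilt.
Qed.

Lemma inconsistent_automorphism s X W (R : (X -> C) -> (W -> C) -> Prop) k a :
  automorphism s -> (forall d a, R d a <-> R (s \o d) (s \o a)) ->
  inconsistent R k a -> inconsistent R k (fun j => s \o a j).
Proof.
move=> [[t sK tK] _ _] Rs.
apply: (inconsistent_imply (h := fun d => t \o d)) => d j /=.
rewrite [X in _ -> X]Rs (_ : s \o (t \o d) = d) //.
by apply/funext => x /=; rewrite tK.
Qed.

Section Rank.
Variables (I X W : Type) (R : I -> (X -> C) -> (W -> C) -> Prop) (k : nat).

(** Shelah's local rank [D] with respect to [R] and [k], at finite values. [P] is an arbitrary set,
    so that complete types can be ranked as well. *)
Fixpoint rank_ge (N : nat) (P : (X -> C) -> Prop) : Prop :=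
  if N is N'.+1 then
    exists l (a : nat -> W -> C), inconsistent (R l) k a /\
      forall j, rank_ge N' (fun d => P d /\ R l d (a j))
  else exists d, P d.

Lemma rank_ge_sub N (P P' : (X -> C) -> Prop) :
  (forall d, P d -> P' d) -> rank_ge N P -> rank_ge N P'.
Proof.
elim: N P P' => [|N IH] P P' PP' /=; first by move=> [d /PP']; exists d.
move=> [l [a [Ra Ha]]]; exists l, a; split=> // j.
by apply: IH (Ha j) => d [/PP'].
Qed.

Lemma rank_ge_nonempty N P : rank_ge N P -> exists d, P d.
Proof.
by elim: N P => //= N IH P [l [a [_ /(_ 0)/IH[d [Pd _]]]]]; exists d.
Qed.

Lemma rank_ge_automorphism s N (P P' : (X -> C) -> Prop) :
  automorphism s ->
  (forall l d a, R l d a <-> R l (s \o d) (s \o a)) ->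
  (forall d, P d -> P' (s \o d)) -> rank_ge N P -> rank_ge N P'.
Proof.
move=> sa Rs; elim: N P P' => [|N IH] P P' PP' /=.
  by move=> [d /PP']; exists (s \o d).
move=> [l [a [Ra Ha]]]; exists l, (fun j => s \o a j); split.
  exact: inconsistent_automorphism Ra.
move=> j; apply: IH (Ha j) => d [/PP' P'd]; rewrite Rs.
by split.
Qed.

(** Each member of the witnessing family keeps its rank on some piece; infinitely many members share
    the same piece, and passing to them preserves inconsistency. *)
Lemma rank_ge_cover (J : finType) (Q : J -> (X -> C) -> Prop) N P :
  (forall d, P d -> exists j, Q j d) -> rank_ge N P ->
  exists j, rank_ge N (fun d => P d /\ Q j d).
Proof.
elim: N P => [|N IH] P PQ /=.
  by move=> [d Pd]; have [j Qj] := PQ d Pd; exists j, d.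
move=> [l [a [Ra Ha]]].
have /choice[f Hf] : forall n, exists j,
    rank_ge N (fun d => (P d /\ R l d (a n)) /\ Q j d).
  by move=> n; apply: IH (Ha n) => d [/PQ].
have [j [g [glt fg]]] := pigeonhole_increasing f.
exists j, l, (a \o g); split; first exact: inconsistent_subseq.
move=> n; have := Hf (g n); rewrite fg; apply: rank_ge_sub => d.
by move=> [[]].
Qed.

End Rank.

(** [n i] is a budget for [R i]. After a first step with [R l], where [n l] may be taken positive,
    induction applies with the budget of [l] lowered by one: either some branch reaches the budget
    of another relation, or all branches reach that of [l] and the first step supplies the missing
    unit. *)
Lemma rank_ge_single (I : finType) X W
    (R : I -> (X -> C) -> (W -> C) -> Prop) k (n : I -> nat) P :
  rank_ge R k (\sum_i n i).+1 P ->
  exists l, rank_ge (fun _ : unit => R l) k (n l) P.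
Proof.
move E : (\sum_i n i) => N; elim: N => [|N IH] in n P E *.
  (* The extra unit of rank produces an index, since [I] might be empty. *)
  move=> H; have [d Pd] := rank_ge_nonempty H; case: H => l _; exists l.
  move/eqP: E; rewrite sum_nat_eq0 => /forallP/(_ l)/eqP -> //.
  by exists d.
move=> H; have [d Pd] := rank_ge_nonempty H.
case: H => l [a [Ra Ha]].
case nl: (n l) => [|m]; first by exists l; rewrite nl; exists d.
pose n' i := if i == l then m else n i.
have En' : \sum_i n' i = N.
  move: E; rewrite (bigD1 l) // [in X in _ -> X](bigD1 l) //= nl addSn => -[<-].
  rewrite {1}/n' eqxx; congr addn; apply: eq_bigr => i il.
  by rewrite /n' (negbTE il).
have [f Hf] := choice (fun j => IH n' _ En' (Ha j)).
have [[j fj]|nf] := pselect (exists j, f j != l).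
  exists (f j); have := Hf j; rewrite /n' (negbTE fj).
  by apply: rank_ge_sub => e [].
exists l; rewrite nl; exists tt, a; split=> // j.
have := Hf j; rewrite (_ : f j = l) ?/n' ?eqxx //.
by apply: contrapT => /eqP fj; apply: nf; exists j.
Qed.

Lemma rank_ge_tree X W (R : (X -> C) -> (W -> C) -> Prop) k N P :
  rank_ge (fun _ : unit => R) k N P ->
  exists a : seq nat -> W -> C,
    (forall s, size s < N -> inconsistent R k (fun i => a (rcons s i))) /\
    (forall s, size s <= N -> exists d, P d /\
       forall j, 0 < j <= size s -> R d (a (take j s))).
Proof.
elim: N P => [|N IH] P /=.
  move=> [d Pd]; have [c0] := dom_inhabited C.
  exists (fun _ _ => c0); split=> // -[|//] _; exists d; split=> // -[|j] //.
move=> [_ [a [Ra Ha]]]; have [T HT] := choice (fun j => IH _ (Ha j)).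
(* The root value [a 0] is a dummy, as only prefixes of positive length are read. The root of each
   subtree [T i] is likewise a dummy, replaced by [a i]. *)
exists (fun s =>
  if s is i :: s' then if s' is [::] then a i else T i s' else a 0).
split=> [[_|i s]|[_|i s]] //=.
- rewrite ltnS => sN.
  apply: (inconsistent_imply (h := id)) ((HT i).1 s sN) => d j.
  by case: s {sN}.
- have [d [[Pd _] _]] := (HT 0).2 [::] (leq0n N).
  by exists d; split=> // -[|j].
rewrite ltnS => sN; have [d [[Pd Rd] Hd]] := (HT i).2 s sN.
exists d; split=> // -[|j] //= js.
case: j js => [|j] js; first by rewrite take0.
by case: s sN Hd js => [//|i' s] sN Hd js /=; exact: (Hd j.+1).
Qed.

Definition relation_of_formula X W (phi : formula L (X + W)) (d : X -> C)
  (a : W -> C) := sat (pairv d a) phi.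

Lemma simple_tree_bounded (X W : finType) (phi : formula L (X + W)) k
    (a : seq nat -> W -> C) :
  simple C ->
  (forall s, inconsistent (relation_of_formula phi) k
               (fun i => a (rcons s i))) ->
  ~ (forall s, exists d, forall j, 0 < j <= size s ->
       sat (pairv d (a (take j s))) phi).
Proof.
move=> simpleC Ha Hb.
pose g (x : X + W) : 'I_#|X| + 'I_#|W| :=
  match x with inl x => inl (enum_rank x) | inr w => inr (enum_rank w) end.
have gE d e : sat (pairv d (e \o enum_val)) (rename g phi) <->
    sat (pairv (d \o enum_rank) e) phi.
  rewrite sat_rename (_ : _ \o g = pairv (d \o enum_rank) e) //.
  by apply/funext; case=> //= w; rewrite enum_rankK.
(* [k.+2] meets the demand that the bound be at least 2; inconsistency persists when [k] grows. *)
apply: (simpleC _ _ (rename g phi)); exists k.+2, (fun s => a s \o enum_val).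
split=> // [s|eta J finJ J1].
  apply: (@inconsistent_leq _ _ (relation_of_formula (rename g phi)) k).
    exact: leqW.
  apply: (inconsistent_imply (h := fun d => d \o enum_rank)) (Ha s) => d j.
  by move/gE.
have [N HN] := finite_set_nat_bounded finJ.
have [d Hd] := Hb (mkseq eta N).
exists (d \o enum_val) => j Jj; apply/gE.
rewrite (_ : (d \o _) \o _ = d); last first.
  by apply/funext => x /=; rewrite enum_rankK.
have jN := HN j Jj; have /= j1 := J1 j Jj.
have := Hd j; rewrite size_mkseq j1 jN => /(_ isT).
by rewrite /mkseq -map_take take_iota (minn_idPl jN).
Qed.

Lemma definable2_exists A (X Y V : Type) (g : Y -> V)
    (R : (X -> C) -> (Y -> C) -> Prop) :
  definable2 A R -> definable A (fun v => exists d, R d (v \o g)).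
Proof.
move=> dR; pose h (x : X + Y) : X + V :=
  match x with inl x => inl x | inr y => inr (g y) end.
exact: definable_ext (definable_exists (definable_rename h dR)) => v.
Qed.

(** Unbounded rank yields trees of every finite height, and compactness an infinite one. Adding the
    parameters from [A] to every node turns [R] into a parameter-free formula, which then has the
    tree property. *)
Lemma simple_rank_bounded A (X W : finType)
    (R : (X -> C) -> (W -> C) -> Prop) k :
  simple C -> small A -> definable2 A R ->
  exists N, ~ rank_ge (fun _ : unit => R) k N setT.
Proof.
move=> simpleC sA dR; apply: contrapT => /forallNP nN.
have [D [p [theta thetaE]]] := definable2_finite_params dR.
pose V : countType := (seq nat * W)%type.
pose sub (v : V -> C) (s : seq nat) := (fun w => v (s, w)) : W -> C.
(* Two kinds of conditions: the children of [s] listed by [i] have no common solution, and the path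
   to [s] has one. *)
pose Z : countType := (seq nat * {ffun 'I_k -> nat} + seq nat)%type.
pose P (z : Z) (v : V -> C) :=
  match z with
  | inl (s, i) => {homo i : l1 l2 / l1 < l2} ->
      ~ exists d, forall l, R d (sub v (rcons s (i l)))
  | inr s => exists d, forall j : 'I_(size s).+1, 0 < j ->
      R d (sub v (take j s))
  end.
pose h (z : Z) := match z with inl (s, _) => (size s).+1 | inr s => size s end.
have dsub s :
    definable A (fun v : X + V -> C => R (v \o inl) (sub (v \o inr) s)).
  exact: (definable_rename (fun x : X + W =>
    match x with inl x => inl x | inr w => inr (s, w) end) dR).
have [||v Pv] :=
  compactness_countable infinite_K saturated_C sA (P := P) (h := h).
- case=> [[s i]|s].
    apply: definable_imp; first exact: definable_const.
    apply/definable_not/(@definable_exists _ _ _ _ _ (fun v : X + V -> C =>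
       forall l, R (v \o inl) (sub (v \o inr) (rcons s (i l))))).
    by apply: definable_forall_fin => l.
  apply: (@definable_exists _ _ _ _ _ (fun v : X + V -> C =>
    forall j : 'I_(size s).+1,
      0 < j -> R (v \o inl) (sub (v \o inr) (take j s)))).
  apply: definable_forall_fin => j.
  by apply: definable_imp; [exact: definable_const|].
- move=> N; have [a [Ha Hb]] := rank_ge_tree (contrapT (nN N)).
  exists (fun x => a x.1 x.2) => -[[s i]|s] /= sN.
    by move=> ilt; apply: Ha.
  have [d [_ Hd]] := Hb s sN; exists d => j j0; apply: Hd.
  by rewrite j0 -ltnS ltn_ord.
apply: (@simple_tree_bounded X D theta k
         (fun s => pairv (sub v s) (params A) \o p)) => // s.
  move=> i ilt [d Hd]; apply: (Pv (inl (s, [ffun l => i l]))) => /=.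
    by move=> x y xy; rewrite !ffunE; apply: ilt.
  by exists d => l; rewrite ffunE; apply/thetaE; apply: Hd.
have [d Hd] := Pv (inr s); exists d => j /andP[j0 js]; apply/thetaE.
have jlt : j < (size s).+1 by [].
exact: (Hd (Ordinal jlt)).
Qed.

Lemma simple_rank_bounded_fin A (I X W : finType)
    (R : I -> (X -> C) -> (W -> C) -> Prop) k :
  simple C -> small A -> (forall l, definable2 A (R l)) ->
  exists N, ~ rank_ge R k N setT.
Proof.
move=> simpleC sA dR.
have [n Hn] := choice (fun l => simple_rank_bounded k simpleC sA (dR l)).
by exists (\sum_l n l).+1 => /rank_ge_single[l]; apply: Hn.
Qed.

End BoundedRank.

(** * Forking *)

Section DefinableRelations.
Variables (L : language) (C : structure L).
Implicit Types A B : set C.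
Notation params A := (fun a : A => \val a : C).

Lemma definable2_formula A X W (phi : formula L (X + W)) :
  definable2 A (relation_of_formula (C := C) phi).
Proof.
exists (rename inl phi) => v.
by rewrite /sat_over sat_rename /relation_of_formula -pairvE.
Qed.

Lemma definable2_swap A X Y (R : (X -> C) -> (Y -> C) -> Prop) :
  definable2 A R -> definable2 A (fun y x => R x y).
Proof.
exact: (definable_rename
  (fun z : X + Y => match z with inl x => inr x | inr y => inl y end)).
Qed.

Lemma definable2_apply A B X Y (R : (X -> C) -> (Y -> C) -> Prop) (b : Y -> C) :
  A `<=` B -> range b `<=` B -> definable2 A R -> definable B (fun d => R d b).
Proof.
move=> AB bB dR.
have bmem y : b y \in B by apply/mem_set/bB; exists y.
pose g (z : X + Y) : X + B :=
  match z with inl x => inl x | inr y => inr (SigSub (bmem y)) end.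
exact: (definable_comp g AB dR).
Qed.

Lemma definable_setU_range A X Y (b : Y -> C) (Q : (X -> C) -> Prop) :
  definable (A `|` range b) Q ->
  exists2 R : (X -> C) -> (Y -> C) -> Prop,
    definable2 A R & forall d, Q d <-> R d b.
Proof.
move=> [psi E].
have /choice[h Hh] : forall z : A `|` range b, exists y,
    pairv b (params A) y = \val z.
  move=> [z /= zm]; have [Az|[y _ <-]] := set_mem zm; last by exists (inl y).
  by exists (inr (SigSub (mem_set Az))).
pose g (z : X + (A `|` range b)) : (X + Y) + A :=
  match z with
  | inl x => inl (inl x)
  | inr z => match h z with inl y => inl (inr y) | inr a => inr a end
  end.
exists (fun d b' => sat (pairv (pairv d b') (params A) \o g) psi).
  by exists (rename g psi) => v; rewrite /sat_over sat_rename -pairvE.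
move=> d; rewrite E /sat_over.
rewrite (_ : pairv (pairv d b) (params A) \o g =
             pairv d (params (A `|` range b))) //.
apply/funext; case=> //= z; rewrite -Hh.
by case: (h z).
Qed.

Lemma fixing_automorphism_definable2 A s X Y
    (R : (X -> C) -> (Y -> C) -> Prop) d a :
  fixing_automorphism A s -> definable2 A R -> R d a <-> R (s \o d) (s \o a).
Proof.
by move=> sA dR; exact: (fixing_automorphism_definable (pairv d a) sA dR).
Qed.

Definition adjoin A W (b : nat -> W -> C) (S : set nat) :=
  A `|` [set x | exists j w, S j /\ x = b j w].

Lemma adjoin_sub A W (b : nat -> W -> C) (S : set nat) B :
  A `<=` B -> (forall j w, S j -> B (b j w)) -> adjoin A b S `<=` B.
Proof. by move=> AB bB x [/AB//|[j [w [Sj ->]]]]; apply: bB. Qed.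

Lemma sub_adjoin A W (b : nat -> W -> C) S : A `<=` adjoin A b S.
Proof. by left. Qed.

Lemma mem_adjoin A W (b : nat -> W -> C) (S : set nat) j w :
  S j -> adjoin A b S (b j w).
Proof. by move=> Sj; right; exists j, w. Qed.

Lemma kdivides_sub A B X W (R : (X -> C) -> (W -> C) -> Prop) k a :
  A `<=` B -> kdivides R k B a -> kdivides R k A a.
Proof.
move=> AB [a_ [aa Ra]]; exists a_; split=> // i.
exact: eqtp_sub (aa i).
Qed.

Lemma kdivides_eqtp A X W (R : (X -> C) -> (W -> C) -> Prop) k a a' :
  eqtp A a a' -> kdivides R k A a -> kdivides R k A a'.
Proof.
move=> aa' [a_ [aa Ra]]; exists a_; split=> // i.
exact: eqtp_trans (eqtp_sym aa') (aa i).
Qed.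

Lemma kdivides_leq A X W (R : (X -> C) -> (W -> C) -> Prop) k k' a :
  k <= k' -> kdivides R k A a -> kdivides R k' A a.
Proof.
move=> kk' [a_ [aa Ra]]; exists a_; split=> //.
exact: inconsistent_leq Ra.
Qed.

Lemma kdivides_imply A X W (R R' : (X -> C) -> (W -> C) -> Prop) k a :
  (forall d a, R' d a -> R d a) -> kdivides R k A a -> kdivides R' k A a.
Proof.
move=> RR' [a_ [aa Ra]]; exists a_; split=> //.
by apply: (inconsistent_imply (h := id)) Ra => d j /RR'.
Qed.

End DefinableRelations.

(** * Forking covers and nonforking extensions *)

Section Forking.
Variables (L : language) (K : Type) (C : structure L).
Hypothesis infinite_K : [set: nat] #<= [set: K].
Hypothesis saturated_C : saturated K C.
Hypothesis homogeneous_C : strongly_homogeneous K C.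
Implicit Types A B : set C.

Notation small A := (card_lt A K).
Notation params A := (fun a : A => \val a : C).

Lemma small_sub A B : A `<=` B -> small B -> small A.
Proof.
move=> /subset_card_le AB [BK nKB]; split; first exact: card_le_trans BK.
by move=> KA; apply: nKB; apply: card_le_trans AB.
Qed.

Lemma small_adjoin A (W : finType) (b : nat -> W -> C) (S : set nat) N :
  (forall j, S j -> j < N) -> small A -> small (adjoin A b S).
Proof.
move=> SN /(card_lt_setU_range
  (fun p : 'I_N * W => b p.1 p.2) infinite_K); apply: small_sub.
apply: adjoin_sub => [x Ax|j w /SN jN]; first by left.
by right; exists (Ordinal jN, w).
Qed.

(** Automorphisms over [A] that carry [e \o h] to its conjugates carry the rest of [e] along. *)
Lemma kdivides_extend A X (W W' : finType) (h : W -> W')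
    (R : (X -> C) -> (W -> C) -> Prop) k (e : W' -> C) :
  small A -> kdivides R k A (e \o h) ->
  kdivides (fun d a => R d (a \o h)) k A e.
Proof.
move=> sA [a_ [aa Ra]].
have /choice[s Hs] : forall j, exists s,
    fixing_automorphism A s /\ s \o (e \o h) = a_ j.
  move=> j; have [s ? ?] :=
    eqtp_automorphism infinite_K homogeneous_C sA (aa j).
  by exists s.
exists (fun j => s j \o e); split=> [j|].
  by apply: fixing_automorphism_eqtp; have [] := Hs j.
apply: (inconsistent_imply (h := id)) Ra => d j.
by rewrite -(Hs j).2.
Qed.

(** All the dividing formulas share one tuple [e] and one [k]. Over a small [A] nothing is lost:
    tuples can be joined and bounds replaced by their maximum. *)
Definition forks_set A X (Q : (X -> C) -> Prop) :=
  exists (I W : finType) (phi : I -> formula L (X + W)) (e : W -> C) k,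
    (forall l, kdivides (relation_of_formula (phi l)) k A e) /\
    forall d, Q d -> exists l, sat (pairv d e) (phi l).

(* tp(c/B) does not fork over A. *)
Definition nonforking A B X (c : X -> C) :=
  forall Q, definable B Q -> Q c -> ~ forks_set A Q.

Lemma forks_set_sub A X (Q Q' : (X -> C) -> Prop) :
  (forall d, Q d -> Q' d) -> forks_set A Q' -> forks_set A Q.
Proof.
move=> QQ' [I [W [phi [e [k [phi_div Q'phi]]]]]].
by exists I, W, phi, e, k; split=> // d /QQ'/Q'phi.
Qed.

Lemma forks_set_base A B X (Q : (X -> C) -> Prop) :
  A `<=` B -> forks_set B Q -> forks_set A Q.
Proof.
move=> AB [I [W [phi [e [k [phi_div Qphi]]]]]].
exists I, W, phi, e, k; split=> // l.
exact: kdivides_sub (phi_div l).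
Qed.

Lemma forks_set0 A X : forks_set A (fun _ : X -> C => False).
Proof.
exists void, void, (of_void _), (of_void C), 0.
by split=> // -[].
Qed.

Lemma forks_setU A X (Q Q' : (X -> C) -> Prop) :
  small A -> forks_set A Q -> forks_set A Q' ->
  forks_set A (fun d => Q d \/ Q' d).
Proof.
move=> sA [I [W [phi [e [k [phi_div Qphi]]]]]].
move=> [I' [W' [phi' [e' [k' [phi'_div Q'phi']]]]]].
pose g (z : X + W) : X + (W + W') :=
  match z with inl x => inl x | inr w => inr (inl w) end.
pose g' (z : X + W') : X + (W + W') :=
  match z with inl x => inl x | inr w => inr (inr w) end.
have gE d (a : W + W' -> C) : pairv d a \o g = pairv d (a \o inl).
  by apply/funext; case.
have g'E d (a : W + W' -> C) : pairv d a \o g' = pairv d (a \o inr).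
  by apply/funext; case.
exists (I + I')%type, (W + W')%type,
  (fun z => match z with inl l => rename g (phi l)
                       | inr l => rename g' (phi' l) end),
  (pairv e e'), (maxn k k').
split=> [[l|l]|d [/Qphi[l Hl]|/Q'phi'[l Hl]]].
- apply: (@kdivides_leq _ _ _ _ _ _ k); first exact: leq_maxl.
  apply: kdivides_imply
    (kdivides_extend (h := inl) (e := pairv e e') sA (phi_div l)).
  by move=> d a; rewrite /relation_of_formula sat_rename gE.
- apply: (@kdivides_leq _ _ _ _ _ _ k'); first exact: leq_maxr.
  apply: kdivides_imply
    (kdivides_extend (h := inr) (e := pairv e e') sA (phi'_div l)).
  by move=> d a; rewrite /relation_of_formula sat_rename g'E.
- by exists (inl l); rewrite sat_rename gE.
- by exists (inr l); rewrite sat_rename g'E.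
Qed.

Lemma kdivides_forks_set A X W (R : (X -> C) -> (W -> C) -> Prop) k b :
  definable2 A R -> kdivides R k A b -> forks_set A (fun d => R d b).
Proof.
move=> /definable2_finite_params[D [p [theta thetaE]]] [b_ [bb Rb]].
exists unit, D, (fun=> theta), (pairv b (params A) \o p), k.
split=> [_|d /thetaE]; last by exists tt.
exists (fun j => pairv (b_ j) (params A) \o p).
split=> [j|]; first exact: eqtp_params.
by apply: (inconsistent_imply (h := id)) Rb => d j /thetaE.
Qed.

Lemma nonforking_sub A A' B B' X (c : X -> C) :
  A `<=` A' -> B' `<=` B -> nonforking A B c -> nonforking A' B' c.
Proof.
move=> AA' BB nf Q dQ Qc /(forks_set_base AA').
by apply: nf => //; apply: definable_sub dQ.
Qed.

(** A forking [Q] would have rank at least [N] for every [N]: some piece of the cover keeps the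
    rank, and automorphisms over [A], which preserve [Q], carry that piece to every member of an
    inconsistent family. *)
Lemma simple_nonforking A (X : finType) (c : X -> C) :
  simple C -> small A -> nonforking A A c.
Proof.
move=> simpleC sA Q dQ Qc [I [W [phi [e [k [phi_div Qphi]]]]]].
pose R l := relation_of_formula (C := C) (phi l).
have dR l : definable2 A (R l) by apply: definable2_formula.
have [N] := simple_rank_bounded_fin infinite_K saturated_C k simpleC sA dR.
apply; apply: (@rank_ge_sub _ _ _ _ _ _ _ _ Q) => //.
elim: N => [|N IH]; first by exists c.
have [l Hl] := rank_ge_cover Qphi IH.
have [a_ [aa Ra]] := phi_div l.
exists l, a_; split=> // j.
have [s sA' sa] := eqtp_automorphism infinite_K homogeneous_C sA (aa j).
apply: (rank_ge_automorphism sA'.1) Hl => [l' d a|d [Qd Rd]].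
  exact: (fixing_automorphism_definable2 _ _ sA' (dR l')).
split; first by apply/(fixing_automorphism_definable d sA' dQ).
by rewrite -sa -(fixing_automorphism_definable2 _ _ sA' (dR l)).
Qed.

(** An index pairs a formula of tp(e/B) with a forking formula over [B']; its condition asks for the
    first and the negation of the second. Were it unsatisfiable, the first would imply the second
    and fork over [A]. *)
Lemma nonforking_extension A B B' (W : countType) (e : W -> C) :
  small A -> small B' -> B `<=` B' -> nonforking A B e ->
  exists2 e', eqtp B e e' & nonforking A B' e'.
Proof.
move=> sA sB' BB' nf.
pose cond (Q : ((W -> C) -> Prop) * ((W -> C) -> Prop)) :=
  [/\ definable B Q.1, Q.1 e, definable B' Q.2 & forks_set A Q.2].
have cond_left Q : definable B Q -> Q e -> cond (Q, fun=> False).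
  move=> dQ Qe; split; rewrite //=; first exact: definable_false.
  exact: forks_set0.
have cond_right Q : definable B' Q -> forks_set A Q -> cond (fun=> True, Q).
  by move=> dQ fQ; split; rewrite //=; exact: definable_const.
pose Idx := {Q | cond Q}.
have [||[[Q Q'] [dQ Qe dQ' fQ']]|e' He'] := compactness infinite_K saturated_C
    (exist cond _ (cond_left _ (definable_const _ _ True) I) : Idx) sB'
    (P := fun (i : Idx) v => (sval i).1 v /\ ~ (sval i).2 v).
- move=> [[Q Q'] [dQ Qe dQ' fQ']] /=; apply: definable_and.
    exact: definable_sub dQ.
  exact: definable_not.
- move=> [[Q Q'] [/= dQ Qe dQ' fQ']] [[S S'] [/= dS Se dS' fS']].
  have cQS : cond (fun v => Q v /\ S v, fun v => Q' v \/ S' v).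
    split=> //=; first exact: definable_and.
      apply: definable_ext
        (definable_not (definable_and (definable_not dQ') (definable_not dS'))).
      by move=> v; rewrite -not_orE notK.
    exact: forks_setU.
  exists (exist _ _ cQS) => v /= [[Qv Sv]] /not_orP[].
  by [].
- move=> /=; apply: contrapT => nQ.
  apply: (nf Q dQ Qe); apply: forks_set_sub fQ' => d Qd.
  by apply: contrapT => nQ'd; apply: nQ; exists d.
exists e' => [Q dQ Qe|Q dQ Qe' fQ].
  exact: (He' (exist _ _ (cond_left Q dQ Qe))).1.
exact: (He' (exist _ _ (cond_right Q dQ fQ))).2.
Qed.

Lemma nonforking_sequence A B (W : finType) (e : W -> C) :
  small A -> small B -> nonforking A B e ->
  exists b : nat -> W -> C, forall i,
    eqtp B e (b i) /\ nonforking A (adjoin B b [set j | j < i]) (b i).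
Proof.
move=> sA sB nf.
pose B' (s : seq (W -> C)) :=
  B `|` range (fun p : 'I_(size s) * W => nth e s p.1 p.2).
have /choice[f Hf] : forall s, exists e', eqtp B e e' /\ nonforking A (B' s) e'.
  move=> s; have [|x Bx|e' ? ?] := nonforking_extension (B' := B' s) sA _ _ nf.
  - exact: card_lt_setU_range.
  - by left.
  - by exists e'.
pose S n := iter n (fun s => rcons s (f s)) [::].
have sizeS n : size (S n) = n by elim: n => //= n IH; rewrite size_rcons IH.
have nthS n i : i < n -> nth e (S n) i = f (S i).
  elim: n => // n IH; rewrite ltnS leq_eqVlt nth_rcons sizeS.
  by move=> /orP[/eqP->|iltn]; rewrite ?ltnn ?eqxx // iltn IH.
exists (fun i => f (S i)) => i; have [fe fnf] := Hf (S i); split=> //.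
apply: nonforking_sub fnf => //.
apply: adjoin_sub => [x Bx|j w ji]; first by left.
have jS : j < size (S i) by rewrite sizeS.
by right; exists (Ordinal jS, w) => //=; rewrite nthS.
Qed.

End Forking.

(** * Independent sequences and symmetry *)

Section Symmetry.
Variables (L : language) (K : Type) (C : structure L).
Hypothesis infinite_K : [set: nat] #<= [set: K].
Hypothesis saturated_C : saturated K C.
Hypothesis homogeneous_C : strongly_homogeneous K C.
Implicit Types A B : set C.

Notation small A := (card_lt A K).

(** Compactness provides [d'] and tuples y_j such that each (d', y_j) has the type of (d, b) over
    [B] and the instances of [R] at the y_j are [k]-inconsistent; an automorphism over [B] then
    moves [d'] to [d]. *)
Lemma nonforking_kdivides A B (X D W : finType)
    (R : (X -> C) -> (W -> C) -> Prop) k (b : W -> C) (d : D -> C) :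
  small B -> A `<=` B -> definable2 B R -> kdivides R k B b ->
  nonforking A (B `|` range b) d -> kdivides R k (B `|` range d) b.
Proof.
move=> sB AB dR [b_ [bb Rb]] nf; have [c0] := dom_inhabited C.
pose V : countType := (D + nat * W)%type.
pose y (v : V -> C) (j : nat) : W -> C := fun w => v (inr (j, w)).
pose cond (S : (D -> C) -> (W -> C) -> Prop) := definable2 B S /\ S d b.
pose P (i : {S | cond S} * nat) (v : V -> C) :=
  (forall j : 'I_i.2, sval i.1 (v \o inl) (y v j)) /\
  (forall f : {ffun 'I_k -> 'I_i.2}, {homo f : l1 l2 / l1 < l2} ->
     ~ exists x, forall l, R x (y v (f l))).
have i0 : {S | cond S}.
  by exists (fun _ _ => True); split=> //; exact: definable_const.
have [|||v Pv] := compactness infinite_K saturated_C (i0, 0) sB (P := P).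
- move=> [[S [dS Sdb]] N]; apply: definable_and.
    apply: definable_forall_fin => j /=.
    exact: (definable_rename (fun z : D + W =>
      match z with inl x => inl x | inr w => inr (j : nat, w) end : V) dS).
  apply: definable_forall_fin => f; apply: definable_imp.
    exact: definable_const.
  apply/definable_not/(@definable_exists _ _ _ _ _ (fun u : X + V -> C =>
    forall l, R (u \o inl) (y (u \o inr) (f l)))).
  apply: definable_forall_fin => l.
  exact: (definable_rename (fun z : X + W =>
    match z with inl x => inl x | inr w => inr (inr (f l : nat, w)) end) dR).
- move=> [[S [dS Sdb]] N] [[S' [dS' S'db]] N'].
  have cSS : cond (fun d b => S d b /\ S' d b).
    by split=> //; exact: definable_and.
  exists (exist _ _ cSS, maxn N N') => v [/= Sv Rv]; split; split=> /=.
  + by move=> j; have [] := Sv (widen_ord (leq_maxl N N') j).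
  + move=> f flt [x Rx].
    apply: (Rv [ffun l => widen_ord (leq_maxl N N') (f l)]).
      by move=> l1 l2 l12; rewrite !ffunE; apply: flt.
    by exists x => l; rewrite ffunE; exact: Rx.
  + by move=> j; have [] := Sv (widen_ord (leq_maxr N N') j).
  + move=> f flt [x Rx].
    apply: (Rv [ffun l => widen_ord (leq_maxr N N') (f l)]).
      by move=> l1 l2 l12; rewrite !ffunE; apply: flt.
    by exists x => l; rewrite ffunE; exact: Rx.
- move=> [[S [dS Sdb]] N]; rewrite /P /=.
  (* S(x,b) lies in tp(d/Bb), hence does not divide over [B]. Testing this on the sequence [b_]
     itself gives [N] instances of [S] along [b_] with a common solution. *)
  have [i [ilt [d' Sd']]] : exists i : 'I_N -> nat,
      {homo i : x y / x < y} /\ exists d', forall l, S d' (b_ (i l)).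
    apply: contrapT => nS; apply: (nf (fun d => S d b)) => //.
      by apply: definable2_apply dS; [left|right].
    apply: (forks_set_base AB); apply: (kdivides_forks_set (k := N) dS).
    by exists b_; split=> // i ilt Hi; apply: nS; exists i.
  exists (fun z : V => match z with
    | inl x => d' x
    | inr (j, w) => if insub j is Some l then b_ (i l) w else c0
    end).
  have yE (l : 'I_N) : y (fun z : V => match z with
    | inl x => d' x
    | inr (j, w) => if insub j is Some l then b_ (i l) w else c0
    end) l = b_ (i l).
    by apply/funext => w; rewrite /y valK.
  split=> [j|f flt [x Rx]]; first by rewrite yE.
  apply: (Rb (i \o f)) => [l1 l2 l12 /=|]; first exact/ilt/flt.
  by exists x => l; have := Rx l; rewrite yE.
have Sv S j : cond S -> S (v \o inl) (y v j).
  by move=> cS; have [/(_ ord_max)] := Pv (exist _ S cS, j.+1).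
have [s sB' sv] : exists2 s, fixing_automorphism B s & s \o (v \o inl) = d.
  apply: (eqtp_automorphism infinite_K homogeneous_C sB).
  apply: eqtp_sym => Q dQ Qd; apply: (Sv (fun d _ => Q d) 0); split=> //.
  exact: (definable_rename inl dQ).
exists (fun j => s \o y v j); split.
  move=> j Q /definable_setU_range[S dS QS]; rewrite !QS => Sbd.
  rewrite -sv -(fixing_automorphism_definable2 (y v j) (v \o inl) sB' dS).
  by apply: (Sv (fun d b => S b d)); split=> //; apply: definable2_swap.
apply: inconsistent_automorphism sB'.1 _ _ => [x a|i ilt [x Rx]].
  exact: (fixing_automorphism_definable2 _ _ sB' dR).
have iN l : i l < (\max_l i l).+1 by rewrite ltnS leq_bigmax.
apply: ((Pv (i0, (\max_l i l).+1)).2 [ffun l => Ordinal (iN l)]).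
  by move=> l1 l2 /ilt; rewrite !ffunE.
by exists x => l; rewrite ffunE; exact: Rx.
Qed.

(** * Rank along an independent sequence *)

Section IndependentSequence.
Variables (A : set C) (I X W : finType).
Variables (R : I -> (X -> C) -> (W -> C) -> Prop) (k : nat) (e : W -> C).
Variables (N : nat) (b : nat -> W -> C).
Hypothesis smallA : small A.
Hypothesis defR : forall l, definable2 A (R l).
Hypothesis divR : forall l, kdivides (R l) k A e.
Hypothesis eqtp_b : forall i, i < N -> eqtp A e (b i).
Hypothesis indep_b : forall i, i < N ->
  nonforking A (adjoin A b [set j | j < i]) (b i).

(** The terms after [b i] enter the base one at a time. The type of [b j] over all earlier terms,
    [b i] among them, does not fork over [A], so adding [b j] preserves the dividing. *)
Lemma independent_kdivides l i j : i < N -> j <= N ->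
  kdivides (R l) k (adjoin A b [set m | i < m < j]) (b i).
Proof.
move=> iN; elim: j => [_|j IH jN].
  apply: (@kdivides_sub _ _ _ A).
    2: exact: kdivides_eqtp (eqtp_b iN) (divR l).
  by apply: adjoin_sub => // j w /=; rewrite ltn0 andbF.
have {}IH := IH (ltnW jN).
have [ij|ji] := ltnP i j; last first.
  apply: kdivides_sub IH; apply: adjoin_sub; first exact: sub_adjoin.
  move=> m w /= /andP[im mj].
  by have := leq_trans im (leq_trans (mj : m <= j) ji); rewrite ltnn.
apply: (@kdivides_sub _ _ _ (adjoin A b [set m | i < m < j] `|` range (b j))).
  apply: adjoin_sub => [x Ax|m w /= /andP[im]]; first by left; left.
  rewrite ltnS leq_eqVlt => /orP[/eqP->|mj]; first by right; exists w.
  by left; apply: mem_adjoin; rewrite /= im.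
apply: (nonforking_kdivides (A := A)) => //.
- by apply: (@small_adjoin _ _ _ infinite_K _ _ _ _ j) => // m /andP[].
- exact: sub_adjoin.
- by apply: definable_sub (defR l); exact: sub_adjoin.
apply: nonforking_sub (indep_b jN) => // x [|[w _ <-]]; last exact: mem_adjoin.
apply: adjoin_sub; first exact: sub_adjoin.
by move=> m v /= /andP[_ mj]; apply: mem_adjoin.
Qed.

(** The rank grows by one as each of [b 0], [b 1], ... leaves the base. An automorphism fixing [A]
    and the terms after [b n], and moving [b n] to a conjugate [a_ j], carries realizations of the
    type of [c] over the old base to realizations of its type over the new base that satisfy [R l]
    at [a_ j]. *)
Lemma independent_rank (c : X -> C) :
  (forall i, i < N -> exists l, R l c (b i)) -> rank_ge R k N setT.
Proof.
move=> Rc.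
suff H n : n <= N -> rank_ge R k n (eqtp (adjoin A b [set m | n <= m < N]) c).
  exact: rank_ge_sub (H N (leqnn N)).
elim: n => [_|n IH nN]; first by exists c.
have [l Rl] := Rc n nN.
have [a_ [ba Ra]] := independent_kdivides l nN (leqnn N).
exists l, a_; split=> // j.
set B := adjoin _ _ _ in ba *.
have sB : small B.
  by apply: (@small_adjoin _ _ _ infinite_K _ _ _ _ N) => // m /andP[].
have [s sfix sb] := eqtp_automorphism infinite_K homogeneous_C sB (ba j).
have AB : A `<=` B by exact: sub_adjoin.
have sA := fixing_automorphism_sub AB sfix.
have BB : B `<=` adjoin A b [set m | n <= m < N].
  apply: adjoin_sub => [x Ax|m w /= /andP[nm mN]]; first by left.
  by apply: mem_adjoin; rewrite /= (ltnW nm).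
apply: (rank_ge_automorphism sfix.1) (IH (ltnW nN)) => [l' d a|d cd].
  exact: (fixing_automorphism_definable2 _ _ sA (defR l')).
split.
  exact: eqtp_trans (eqtp_sub BB cd) (fixing_automorphism_eqtp sfix).
rewrite -sb -(fixing_automorphism_definable2 _ _ sA (defR l)).
apply: (cd (fun d => R l d (b n))) Rl.
apply: definable2_apply (defR l); first exact: sub_adjoin.
by move=> _ [w _ <-]; apply: mem_adjoin; rewrite /= leqnn.
Qed.

End IndependentSequence.

(** The rank bound serves as [N]: by the cover, a common solution of [N] conjugates of R(x,b) along
    an independent sequence would satisfy a dividing formula at each of the [N] terms, giving rank
    at least [N]. *)
Lemma forks_set_kdivides A (X Y : finType) (R : (X -> C) -> (Y -> C) -> Prop)
    (b : Y -> C) :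
  simple C -> small A -> definable2 A R -> forks_set A (fun d => R d b) ->
  exists N, kdivides R N A b.
Proof.
move=> simpleC sA dR [I [W [phi [e [k [phi_div Rphi]]]]]].
pose S l (d : X -> C) (a : W + Y -> C) :=
  relation_of_formula (phi l) d (a \o inl).
pose f := pairv e b.
have S_div l : kdivides (S l) k A f.
  exact: (@kdivides_extend _ _ _ infinite_K homogeneous_C _ _ _ _ inl).
have dS l : definable2 A (S l).
  exact: (definable_rename (fun z : X + W =>
    match z with inl x => inl x | inr w => inr (inl w : W + Y) end)
    (definable2_formula A (phi l))).
have [g Hg] := nonforking_sequence infinite_K saturated_C homogeneous_C sA sA
  (simple_nonforking infinite_K saturated_C homogeneous_C (c := f) simpleC sA).
have [N HN] := simple_rank_bounded_fin infinite_K saturated_C k simpleC sA dS.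
(* Being covered is expressed by the type of [f] over [A], hence passes to each conjugate [g i]. *)
have cover i d : R d (g i \o inr) -> exists l, S l d (g i).
  move=> Rd; apply: contrapT => nS.
  pose Q (a : W + Y -> C) := exists d, R d (a \o inr) /\ forall l, ~ S l d a.
  have dQ : definable A Q.
    apply: (definable2_exists id
      (R := fun d (a : W + Y -> C) => R d (a \o inr) /\ forall l, ~ S l d a)).
    apply: definable_and.
      exact: (definable_rename (fun z : X + Y =>
        match z with inl x => inl x | inr y => inr (inr y : W + Y) end) dR).
    by apply: definable_forall_fin => l; apply: definable_not; apply: dS.
  have [d' [/Rphi[l Hl] /(_ l)]] : Q f; last by apply.
  apply: (eqtp_sym (Hg i).1 dQ); exists d; split=> // l Sl.
  by apply: nS; exists l.
exists N, (fun i => g i \o inr); split.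
  by move=> i; exact: (eqtp_comp (h := inr) (Hg i).1).
move=> i ilt [d Rd]; apply: HN.
(* [h] follows the increasing [i], with dummy value 0 from [N] on; terms chosen earlier are earlier
   in [g], so nonforking is inherited. *)
pose h m := if insub m is Some l then i l else 0.
have hE (m : nat) (mN : m < N) : h m = i (Ordinal mN) by rewrite /h insubT.
apply: (independent_rank sA dS S_div
  (b := g \o h) _ _ (c := d)).
- by move=> m mN; exact: (Hg _).1.
- move=> m mN; apply: nonforking_sub (Hg (h m)).2 => //.
  apply: adjoin_sub; first exact: sub_adjoin.
  move=> j w /= jm; apply: mem_adjoin => /=.
  by rewrite (hE m mN) (hE j (ltn_trans jm mN)); apply: ilt.
by move=> m mN; apply: cover; rewrite /= (hE m mN); exact: Rd.
Qed.

Lemma nonforking_sym A (X Y : finType) (c : X -> C) (b : Y -> C) :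
  simple C -> small A ->
  nonforking A (A `|` range c) b -> nonforking A (A `|` range b) c.
Proof.
move=> simpleC sA nf Q /definable_setU_range[R dR QR] /QR Rcb fQ.
have [|k Rk] := forks_set_kdivides simpleC sA dR (b := b).
  by apply: forks_set_sub fQ => d /QR.
(* These conjugates of [b] are taken over [A] and [c], so [c] satisfies R(x, g i) for every [i] and
   the rank exceeds any bound. *)
have [g Hg] := nonforking_sequence infinite_K saturated_C homogeneous_C sA
  (card_lt_setU_range c infinite_K sA) nf.
have [N] := simple_rank_bounded_fin infinite_K saturated_C k simpleC sA
  (fun _ : unit => dR).
have Asub : A `<=` A `|` range c by left.
apply; apply: (independent_rank sA
  (fun _ => dR) (fun _ => Rk) (b := g) _ _ (c := c)) => i _.
- exact: eqtp_sub (Hg i).1.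
- apply: nonforking_sub (Hg i).2 => //; apply: adjoin_sub.
    by move=> x Ax; apply: sub_adjoin; left.
  by move=> j w; exact: mem_adjoin.
exists tt; apply: ((Hg i).1 (fun y => R c y)) => //.
by apply: definable2_apply (definable2_swap dR) => //; right.
Qed.

(** Finitely many formulas of a type amount to one definable set; the tuples [a l] of various
    arities are joined over the sum of their index types, with the largest [k l] as bound.
    Conversely, finite types are enumerated by ordinals. *)
Lemma forks_nonforking A B n (c : 'I_n -> C) :
  small A -> forks A (tp B c) <-> ~ nonforking A B c.
Proof.
move=> sA; split.
  move=> [r [m [phi [a [phi_div [q [qfin qtp qphi]]]]]]] nf.
  have dQ : definable B (fun d => forall psi, q psi -> sat_over d psi).
    move: qfin => /(finite_seqP (q : set {classic _})).1[s ->].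
    elim: s => [|psi s IH].
      by apply: definable_ext (definable_const B _ True) => d; split.
    have dpsi : definable B (fun d : 'I_n -> C => sat_over d psi) by exists psi.
    apply: definable_ext (definable_and dpsi IH) => d; split.
      by move=> [Hpsi Hs] psi' /=; rewrite inE => /orP[/eqP->//|/Hs].
    move=> H; split=> [|psi' /= psis]; apply: H;
      by rewrite /= inE ?eqxx ?psis ?orbT.
  apply: (nf _ dQ) => [psi /qtp //|].
  have [k Hk] := choice phi_div.
  pose W : finType := {l : 'I_r & 'I_(m l)}.
  pose tag_of l (y : 'I_(m l)) : W := Tagged (fun l => 'I_(m l)) y.
  pose g l (z : 'I_n + 'I_(m l)) : 'I_n + W :=
    match z with inl x => inl x | inr y => inr (tag_of l y) end.
  pose e (w : W) : C := a (tag w) (tagged w).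
  have gE l d (u : W -> C) : pairv d u \o g l = pairv d (u \o tag_of l).
    by apply/funext; case.
  exists 'I_r, W, (fun l => rename (g l) (phi l)), e, (\max_l k l).
  split=> [l|d /qphi[l Hl]]; last by exists l; rewrite sat_rename gE.
  apply: (@kdivides_leq _ _ _ _ _ _ (k l)); first exact: leq_bigmax.
  apply: (@kdivides_imply _ _ _ _ _
    (fun d u => relation_of_formula (phi l) d (u \o tag_of l))).
    by move=> d u; rewrite /relation_of_formula sat_rename gE.
  apply: (kdivides_extend infinite_K homogeneous_C) => //.
  have [a_ [aa Ra]] := Hk l; exists a_; split=> // j.
  exact/tp_eqtp/esym/aa.
move=> /existsNP[Q /not_implyP[[psi Hpsi] /not_implyP[Qc /contrapT]]].
move=> [I [W [phi [e [k [phi_div Qphi]]]]]].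
pose g (z : 'I_n + W) : 'I_n + 'I_#|W| :=
  match z with inl x => inl x | inr w => inr (enum_rank w) end.
have gE d (u : 'I_#|W| -> C) : pairv d u \o g = pairv d (u \o enum_rank).
  by apply/funext; case.
have rankK (u : W -> C) : (u \o enum_val) \o enum_rank = u.
  by apply/funext => w /=; rewrite enum_rankK.
exists #|I|, (fun=> #|W|), (fun l => rename g (phi (enum_val l))).
exists (fun=> e \o enum_val); split.
  move=> l; have [a_ [aa Ra]] := phi_div (enum_val l).
  exists k, (fun j => a_ j \o enum_val); split=> [j|].
    apply/tp_eqtp; apply: eqtp_sym; exact: (eqtp_comp (h := enum_val) (aa j)).
  apply: (inconsistent_imply (h := id)
    (R' := relation_of_formula (rename g (phi (enum_val l))))) Ra => d j.
  by rewrite /relation_of_formula sat_rename gE rankK.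
exists [set psi]; split; first exact: finite_set1.
  by move=> _ ->; apply/Hpsi.
move=> d /(_ psi erefl)/Hpsi/Qphi[l Hl]; exists (enum_rank l).
by rewrite sat_rename gE rankK enum_rankK.
Qed.

End Symmetry.

Theorem lemma6 (L : language) (T : set (sentence L)) (K : Type)
    (C : structure L) :
  complete_theory T ->
  monster_model K T C ->
  simple C ->
  dual_finite_character K C.
Proof.
move=> _ [[LK _] _ saturated_C homogeneous_C] simpleC A m n b c sA.
have infinite_K : [set: nat] #<= [set: K].
  apply: card_le_trans LK.
  by apply: (injective_card_le (f := inl)) => // x y _ _ [].
have sym := nonforking_sym infinite_K saturated_C homogeneous_C simpleC sA.
move=> /(forks_nonforking infinite_K homogeneous_C _ _ sA) forkc.
(* By symmetry [b] satisfies a formula over [A] and [c] that forks over [A]; [R] turns the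
   parameters [c] into variables, and [phi] is [R] with its arguments swapped. *)
have /existsNP[Q /not_implyP[/definable_setU_range[R dR QR]
  /not_implyP[Qb /contrapT forkQ]]] : ~ nonforking A (A `|` range c) b.
  by move=> /sym.
have [phi phiR] := definable2_swap dR.
exists phi; split; first by apply/phiR/QR.
move=> b' /phiR Rb'.
(* Symmetry in the other direction: R(y,c) holds at [b'] and forks over [A], which rules out
   nonforking of the type of [b']. *)
apply/(forks_nonforking infinite_K homogeneous_C _ _ sA) => /sym nf.
apply: (nf (fun y => R y c)) => //.
  by apply: definable2_apply dR; [left|right].
by apply: forks_set_sub forkQ => d /QR.
Qed.
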